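(* Let $\alpha\in\big(\frac12,1\big)$ and let $(c_k)_{k\ge0}$ be the real sequence (depending on $\alpha$) defined by the recursion in the context. Then the convergence radius of the power series $\sum_{k\ge0}c_kt^k$ is infinite. To be more precise, there exist $K\ge\frac1{\Gamma(2-\alpha)}$ and $A\ge2^\alpha$ such that $$\forall\,k\ge0,\qquad|c_k|\le K\,\frac{A^k}{\Gamma(\alpha k+2-\alpha)} .$$ As a consequence, for all $\lambda,c>0$, the expansion $$\varsigma_{\alpha,\lambda,c}^2(t)=2\,\lambda\,c\;t^{1-\alpha}\sum_{k\ge0}(-1)^kc_k\,\lambda^k\,t^{\alpha k}$$ holds for every $t\in\mathbb R_+$ (in fact $\mathbb R$).
   Context: For $\alpha\in(\frac12,1)$ set $a_k=\frac1{\Gamma(\alpha k+1)}$ and $b_k=\frac1{\Gamma(\alpha(k+1))}$, $k\ge0$. For sequences, $(u*v)_k=\sum_{\ell=0}^ku_\ell v_{k-\ell}$ and $b^{*2}=b*b$. The sequence $(c_k)_{k\ge 0}$ is defined by $c_0=\frac{\Gamma(\alpha)^2}{\Gamma(2\alpha-1)\Gamma(2-\alpha)}$ and, for $k\ge1$, $$c_k=\frac{\Gamma(\alpha)^2}{\Gamma(\alpha(k-1)+2)\,\Gamma(2\alpha-1)}\Big[\Gamma(\alpha(k+1))(a*b)_k-\sum_{\ell=1}^k\Gamma(\alpha(\ell+2)-1)\,\Gamma(\alpha(k-\ell-1)+2)\,(b^{*2})_\ell\,c_{k-\ell}\Big].$$ With $R_{\alpha,\lambda}(t)=\sum_{k\ge0}(-1)^k\frac{\lambda^kt^{\alpha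 k}}{\Gamma(\alpha k+1)}$ (the resolvent of the kernel $K_\alpha(t)=t^{\alpha-1}/\Gamma(\alpha)$) and $f_{\alpha,\lambda}=-R'_{\alpha,\lambda}$ on $(0,+\infty)$, the function $\varsigma_{\alpha,\lambda,c}^2$ denotes the solution of $$\forall\,t>0,\qquad c\lambda^2\big(1-R_{\alpha,\lambda}^2(t)\big)=\int_0^tf_{\alpha,\lambda}^2(t-s)\,\varsigma_{\alpha,\lambda,c}^2(s)\,ds$$ (here $\varsigma^2_{\alpha,\lambda,c}$ is a single symbol; its nonnegativity is not part of the claim). *)

(* Defs.v *)
From HB Require Import structures.
From mathcomp Require Import all_boot all_order all_algebra.
From mathcomp Require Import all_classical all_reals all_analysis.
Set Implicit Arguments.
Unset Strict Implicit.
Unset Printing Implicit Defensive.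
Import Order.TTheory GRing.Theory Num.Theory.
Import numFieldNormedType.Exports.
Local Open Scope classical_set_scope.
Local Open Scope ring_scope.

Section Defs.
Context {R : realType}.
Local Notation mu := (@lebesgue_measure R).

(* Euler's integral; it has its usual meaning for x > 0 only, and every
   argument used below is positive when 1/2 < alpha < 1. *)
Definition Gamma (x : R) : R :=
  \int[mu]_(t in `]0, +oo[) (t `^ (x - 1) * expR (- t)).

Definition seqconv (u v : R^nat) : R^nat :=
  fun k => \sum_(0 <= l < k.+1) u l * v (k - l)%N.

Definition cvg_radius (u : R^nat) : \bar R :=
  ereal_sup [set (`|x|)%:E | x in [set x : R | cvgn (pseries u x)]].

Definition seqa (alpha : R) : R^nat :=
  fun k => (Gamma (alpha * k%:R + 1))^-1.

Definition seqb (alpha : R) : R^nat :=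
  fun k => (Gamma (alpha * k.+1%:R))^-1.

(* The right-hand side of the recursion defining c_k for k >= 1; it only reads
   c_0, ..., c_(k-1). *)
Definition c_step (alpha : R) (c : R^nat) (k : nat) : R :=
  Gamma alpha ^+ 2 / (Gamma (alpha * (k%:R - 1) + 2) * Gamma (2 * alpha - 1)) *
  (Gamma (alpha * k.+1%:R) * seqconv (seqa alpha) (seqb alpha) k -
   \sum_(1 <= l < k.+1)
     Gamma (alpha * l.+2%:R - 1) * Gamma (alpha * (k%:R - l%:R - 1) + 2) *
     seqconv (seqb alpha) (seqb alpha) l * c (k - l)%N).

Definition c_recursion (alpha : R) (c : R^nat) : Prop :=
  c 0%N = Gamma alpha ^+ 2 / (Gamma (2 * alpha - 1) * Gamma (2 - alpha)) /\
  forall k : nat, (1 <= k)%N -> c k = c_step alpha c k.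

Lemma c_step_ext (alpha : R) (c d : R^nat) (k : nat) :
  (forall j, (j < k)%N -> c j = d j) -> c_step alpha c k = c_step alpha d k.
Proof.
move=> cd; rewrite /c_step; congr (_ * (_ - _)).
rewrite big_nat_cond [RHS]big_nat_cond; apply: eq_bigr => l.
rewrite andbT => /andP[l1 lk]; congr (_ * _); apply: cd.
by rewrite ltn_subrL l1 (leq_trans l1 lk).
Qed.

Lemma c_recursion_unique (alpha : R) :
  exists! c : R^nat, c_recursion alpha c.
Proof.
pose c0 : R := Gamma alpha ^+ 2 / (Gamma (2 * alpha - 1) * Gamma (2 - alpha)).
pose p := fix p n : R^nat := if n is m.+1 then
  (fun j => if (j <= m)%N then p m j else c_step alpha (p m) m.+1)
  else (fun=> c0).
have pE n j : (j <= n)%N -> p n j = p j j.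
  elim: n => [|n IH]; first by rewrite leqn0 => /eqP ->.
  rewrite leq_eqVlt => /predU1P[->//|]; rewrite ltnS => jn /=.
  by rewrite jn IH.
exists (fun k => p k k); split.
  split=> // -[//|k] _ /=; rewrite ltnn.
  by apply: c_step_ext => j; rewrite ltnS; exact: pE.
move=> d [d0 dS]; apply/funext => n.
elim/ltn_ind: n => -[|n] IH; first by rewrite d0.
rewrite (dS n.+1)//= ltnn; apply: c_step_ext => j jn.
by rewrite pE // IH.
Qed.

Definition resolvent (alpha lambda t : R) : R :=
  limn (series (fun k : nat => (-1) ^+ k *
    (lambda ^+ k * t `^ (alpha * k%:R) / Gamma (alpha * k%:R + 1)))).

Definition resolvent_density (alpha lambda t : R) : R :=
  - derive1 (resolvent alpha lambda) t.

(* phi solves the convolution equation defining varsigma^2.  The solutions are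
   sought among the functions that are locally integrable on [0, +oo[; the
   convolution is a Lebesgue integral, required to converge absolutely. *)
Definition varsigma2_solution (alpha lambda c : R) (phi : R -> R) : Prop :=
  (forall T : R, 0 < T -> mu.-integrable `[0, T] (EFin \o phi)) /\
  forall t : R, 0 < t ->
    mu.-integrable `]0, t[
      (fun s => (resolvent_density alpha lambda (t - s) ^+ 2 * phi s)%:E) /\
    c * lambda ^+ 2 * (1 - resolvent alpha lambda t ^+ 2) =
      \int[mu]_(s in `]0, t[)
        (resolvent_density alpha lambda (t - s) ^+ 2 * phi s).

Definition varsigma2_expansion (alpha lambda c : R) (ck : R^nat) (t : R) : R :=
  2 * lambda * c * t `^ (1 - alpha) *
  limn (series (fun k : nat =>
    (-1) ^+ k * ck k * lambda ^+ k * t `^ (alpha * k%:R))).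

End Defs.

(* Main.v *)
Require Import Defs.
From HB Require Import structures.
From mathcomp Require Import all_boot all_order all_algebra.
From mathcomp Require Import all_classical all_reals all_analysis.
From mathcomp Require Import measurable_realfun.
From mathcomp Require Import ring lra.
Import Order.TTheory GRing.Theory Num.Theory.
Import numFieldNormedType.Exports.
Set Implicit Arguments.
Unset Strict Implicit.
Unset Printing Implicit Defensive.
Local Open Scope classical_set_scope.
Local Open Scope ring_scope.

(** For a fixed [alpha > 0], call exponentially bounded a sequence [u] with
[|u_k| <= K A^k], and attach to it the function
[phi_(beta,u)(t) = sum_k u_k t^(beta + alpha k - 1) / Gamma(beta + alpha k)]
on [t > 0].  Euler's Beta integral says that the convolution over [0, t] of
[t^(x-1)/Gamma(x)] and [t^(y-1)/Gamma(y)] is [t^(x+y-1)/Gamma(x+y)], so that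
convolution of such functions is convolution of their coefficients:
[phi_(beta,u)] convolved with [phi_(gamma,v)] is [phi_(beta+gamma, u conv v)]
([fracseries_convolution]).

All the functions of the theorem belong to this family.  The resolvent is
[phi_1] with coefficients [(-lambda)^k], the density [f] is [phi_alpha], its
pointwise square is [phi_(2 alpha - 1)] with coefficients proportional to
[(-lambda)^k g_k], where [g_k = Gamma(2 alpha - 1 + alpha k) (b conv b)_k], and
the proposed expansion is [phi_(2 - alpha)] with coefficients proportional to
[(-lambda)^k d_k], where [d_k = Gamma(2 - alpha + alpha k) c_k].  The left-hand
side [1 - R^2] is [phi_(1 + alpha)] with coefficients proportional to
[(-lambda)^k r_k], where [r_k = Gamma(alpha (k + 1)) (a conv b)_k].  The
convolution equation therefore reads [g conv d = r], and the recursion that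
defines [c_k] is this identity solved for [d_k] ([f2_coef_expansion_coef]).

For the growth of [c_k], a lower bound of the Beta integral gives
[1 / (Gamma(x) Gamma(y)) <= 2 4^(x+y) / Gamma(x+y)], hence [g] and [r] are
exponentially bounded.  A quotient of exponentially bounded sequences for the
convolution product is exponentially bounded ([expbounded_div]), hence so is
[d]; this is the announced bound.  Since [1 / Gamma(beta + alpha k)] decays
faster than any geometric sequence ([invGamma_decay]), all the series involved
have infinite radius of convergence.

For uniqueness, [g] has a convolution inverse, again exponentially bounded.  It
yields a kernel [h = phi_(2 - 2 alpha)] whose convolution with [f^2] is the
constant [1].  If [psi] is the difference of two solutions, then [f^2]
convolved with [psi] vanishes; convolving with [h] and exchanging the integrals
gives that the integral of [psi] over [0, T] is zero for all [T]
([primitive_eq0]), so [psi] vanishes almost everywhere by Lebesgue's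
differentiation theorem. *)

(** * Affine change of variables *)

Section Affine.
Context {R : realType}.
Local Notation mu := (@lebesgue_measure R).

Lemma measurable_affine (c b : R) :
  measurable_fun setT (fun x : measurableTypeR R => c * x + b : measurableTypeR R).
Proof. by apply: measurable_funD => //; apply: measurable_funM. Qed.

(** Both sides are measures that agree on half-open intervals. *)
Lemma lebesgue_measure_affine (c b : R) (A : set R) : 0 < c -> measurable A ->
  (c%:E * mu ((fun x => c * x + b)%R @^-1` A) = mu A)%E.
Proof.
move=> c0 mA; pose C : {nonneg R} := NngNum (ltW c0).
pose phi := (fun x : measurableTypeR R => c * x + b : measurableTypeR R).
have mphi : measurable_fun setT phi := measurable_affine c b.
(* The measure structure of a pushforward takes the measurability proof of
   the map as an argument that unification does not find. *)
pose m : {measure set (measurableTypeR R) -> \bar R} :=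
  measure_function_pushforward__canonical__measure_function_Measure mu mphi.
apply/esym; apply: (@lebesgue_measure_unique R (mscale C m)) => //.
move=> X [[x y]] _ <-.
rewrite -[RHS]/(c%:E * mu (phi @^-1` `]x, y]))%E.
rewrite [X in (_ * mu X)%E](_ : _ = `](x - b) / c, (y - b) / c]%classic); last first.
  apply/seteqP; split => z /=; rewrite /phi !in_itv/= ltr_pdivrMr// ler_pdivlMr//.
    by rewrite ltrBlDr lerBrDr mulrC.
  by rewrite ltrBlDr lerBrDr mulrC.
rewrite !lebesgue_measure_itv/= !lte_fin ltr_pM2r ?invr_gt0// ltrD2r.
case: ifPn => xy; last by rewrite mule0.
rewrite -!EFinB -EFinM; congr (_%:E).
by field; rewrite gt_eqF.
Qed.

Lemma ge0_integral_affine (c b : R) (f : R -> \bar R) : 0 < c ->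
  measurable_fun setT f -> (forall x, (0 <= f x)%E) ->
  (c%:E * \int[mu]_x f (c * x + b)%R = \int[mu]_x f x)%E.
Proof.
move=> c0 mf f0; pose C : {nonneg R} := NngNum (ltW c0).
pose phi := (fun x : measurableTypeR R => c * x + b : measurableTypeR R).
have mphi : measurable_fun setT phi := measurable_affine c b.
pose m : {measure set (measurableTypeR R) -> \bar R} :=
  measure_function_pushforward__canonical__measure_function_Measure mu mphi.
transitivity (\int[mscale C m]_x f x)%E; last first.
  apply: eq_measure_integral => // A mA _.
  exact: lebesgue_measure_affine.
rewrite ge0_integral_mscale//=; congr (_ * _)%E.
by rewrite (ge0_integral_pushforward mphi).
Qed.

Lemma integral_translation (b : R) (f : R -> \bar R) :
  measurable_fun setT f -> (\int[mu]_x f (x + b)%R = \int[mu]_x f x)%E.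
Proof.
move=> mf.
have E (g : R -> \bar R) : measurable_fun setT g -> (forall x, (0 <= g x)%E) ->
    (\int[mu]_x g (x + b)%R = \int[mu]_x g x)%E.
  move=> mg g0; rewrite -(ge0_integral_affine b ltr01 mg g0) mul1e.
  by apply: eq_integral => x _; rewrite mul1r.
rewrite [LHS]integralE [RHS]integralE; congr (_ - _)%E.
  rewrite -[RHS](E (f^\+)%E)//; first by apply: eq_integral => x _; rewrite !unlock.
  exact: measurable_funepos.
rewrite -[RHS](E (f^\-)%E)//; first by apply: eq_integral => x _; rewrite !unlock.
exact: measurable_funeneg.
Qed.

End Affine.

(** * The Gamma function and Euler's Beta integral *)

Section Gamma_facts.
Context {R : realType}.
Local Notation mu := (@lebesgue_measure R).

(** Extending by zero to the negative half-line turns integrals over [0, t] of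
[f (t - s) * g s] into integrals over the whole line, where translations and
Fubini's theorem apply without side conditions on the domain. *)
Definition pospart (f : R -> R) : R -> R := f \_ `]0, +oo[.

Lemma pospartE f t : 0 < t -> pospart f t = f t.
Proof. by move=> t0; rewrite /pospart patchE mem_set//= in_itv/= t0. Qed.

Lemma pospart0 f t : t <= 0 -> pospart f t = 0.
Proof.
by move=> t0; rewrite /pospart patchE memNset//= in_itv/= andbT ltNge t0.
Qed.

Definition kpow (x : R) : R -> R := pospart (fun t => t `^ (x - 1)).

Lemma kpow_ge0 x t : 0 <= kpow x t.
Proof.
by have [t0|t0] := leP t 0; [rewrite /kpow pospart0|rewrite /kpow pospartE ?powR_ge0].
Qed.

Lemma measurable_kpow x : measurable_fun setT (kpow x).
Proof.
apply/(measurable_restrictT _ _).1 => //.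
by apply: measurable_funTS; exact: measurable_powR.
Qed.

Lemma kpowM x c t : 0 < c -> kpow x (c * t) = c `^ (x - 1) * kpow x t.
Proof.
move=> c0; have [t0|t0] := leP t 0.
  by rewrite /kpow !pospart0 ?mulr0// pmulr_rle0.
by rewrite /kpow !pospartE ?mulr_gt0// powRM// ltW.
Qed.

(** Euler's integral as an extended real: the Beta identity below is then available
before the integral is known to converge. *)
Definition egamma (x : R) : \bar R := (\int[mu]_t (kpow x t * expR (- t))%:E)%E.

Lemma measurable_gamma_integrand x :
  measurable_fun setT (fun t : R => kpow x t * expR (- t)).
Proof.
apply: measurable_funM; first exact: measurable_kpow.
by apply: measurableT_comp => //; exact: measurable_expR.
Qed.

Lemma Gamma_egamma x : Gamma x = fine (egamma x).
Proof.
rewrite /Gamma /Rintegral integral_mkcond; congr fine.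
apply: eq_integral => t _; rewrite patchE /kpow /pospart patchE.
by case: ifPn => _//; rewrite mul0r.
Qed.

Lemma egamma_ge0 x : (0 <= egamma x)%E.
Proof.
by apply: integral_ge0 => t _; rewrite lee_fin mulr_ge0 ?kpow_ge0 ?expR_ge0.
Qed.

Definition kconv (x y t : R) : \bar R :=
  (\int[mu]_s (kpow x (t - s) * kpow y s)%:E)%E.

Lemma measurable_translate_rev (t : R) (f : R -> R) : measurable_fun setT f ->
  measurable_fun setT (fun s : R => f (t - s)).
Proof.
move=> mf; apply: measurableT_comp => //.
by apply: measurable_funB => //; exact: measurable_cst.
Qed.

Lemma kconv_ge0 x y t : (0 <= kconv x y t)%E.
Proof. by apply: integral_ge0 => s _; rewrite lee_fin mulr_ge0 ?kpow_ge0. Qed.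

(** Homogeneity, by the substitution [s = t * s']. *)
Lemma kconvE x y t : kconv x y t = ((kpow (x + y) t)%:E * kconv x y 1)%E.
Proof.
have [t0|t0] := leP t 0.
  rewrite /kpow pospart0// mul0e; apply: integral0_eq => s _.
  have [s0|s0] := leP s 0; first by rewrite [kpow y s]pospart0// mulr0.
  by rewrite [kpow x _]pospart0 ?mul0r//; lra.
have mf : measurable_fun setT (fun s : R => (kpow x (t - s) * kpow y s)%:E).
  apply/measurable_EFinP; apply: measurable_funM; last exact: measurable_kpow.
  apply: measurable_translate_rev; exact: measurable_kpow.
have m1 : measurable_fun setT (fun s : R => (kpow x (1 - s) * kpow y s)%:E).
  apply/measurable_EFinP; apply: measurable_funM; last exact: measurable_kpow.
  apply: measurable_translate_rev; exact: measurable_kpow.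
rewrite {1}/kconv -(ge0_integral_affine 0 t0 mf); last first.
  by move=> s; rewrite lee_fin mulr_ge0 ?kpow_ge0.
rewrite (eq_integral (fun s : measurableTypeR R => (t `^ (x - 1) * t `^ (y - 1))%:E *
    (kpow x (1 - s) * kpow y s)%:E)%E); last first.
  move=> s _; rewrite addr0 -EFinM; congr (_%:E).
  rewrite (_ : t - t * s = t * (1 - s)); last by ring.
  by rewrite !kpowM//; ring.
rewrite ge0_integralZl//; last 2 first.
- by move=> s _; rewrite lee_fin mulr_ge0 ?kpow_ge0.
- by rewrite lee_fin mulr_ge0// powR_ge0.
rewrite muleA -EFinM /kpow pospartE//; congr (_%:E * _)%E.
rewrite -{1}(powRr1 (ltW t0)) -!powRD ?(gt_eqF t0) ?implybT//.
by congr (_ `^ _); ring.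
Qed.

(** Tonelli's theorem for [k_x(t - s) k_y(s) exp(-t)]: integrating in [s] first gives
[exp(-t)] times the convolution, which is [t^(x+y-1)] up to a constant, and
integrating in [t] first gives the product of the two Gamma integrals. *)
Lemma egamma_beta x y : (egamma x * egamma y = egamma (x + y) * kconv x y 1)%E.
Proof.
pose F (z : R * R) : \bar R :=
  (kpow x (z.1 - z.2) * kpow y z.2 * expR (- z.1))%:E.
have mF : measurable_fun setT F.
  apply/measurable_EFinP; apply: measurable_funM.
    apply: measurable_funM.
      apply: (measurableT_comp (measurable_kpow x)).
      by apply: measurable_funB; [exact: measurable_fst|exact: measurable_snd].
    by apply: (measurableT_comp (measurable_kpow y)); exact: measurable_snd.
  apply: (measurableT_comp (@measurable_expR R)).
  by apply: (measurable_funN); exact: measurable_fst.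
have F0 z : (0 <= F z)%E.
  by rewrite lee_fin !mulr_ge0 ?kpow_ge0 ?expR_ge0.
have mg z := measurable_gamma_integrand z.
have := @fubini_tonelli _ _ _ _ R mu mu F mF F0.
rewrite (eq_integral (fun t : measurableTypeR R =>
    (kpow (x + y) t * expR (- t))%:E * kconv x y 1)%E); last first.
  move=> t _; rewrite mulrC EFinM -muleA -kconvE.
  rewrite -ge0_integralZl ?lee_fin ?expR_ge0//; last 2 first.
  - apply/measurable_EFinP; apply: measurable_funM; last exact: measurable_kpow.
    apply: measurable_translate_rev; exact: measurable_kpow.
  - by move=> s _; rewrite lee_fin mulr_ge0 ?kpow_ge0.
  by apply: eq_integral => s _; rewrite /F -EFinM /= mulrC.
rewrite ge0_integralZr//; last 3 first.
- by apply/measurable_EFinP; exact: mg.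
- by move=> s _; rewrite lee_fin mulr_ge0 ?kpow_ge0 ?expR_ge0.
- exact: kconv_ge0.
rewrite -/(egamma _) => ->.
rewrite muleC -ge0_integralZr//; last 3 first.
- by apply/measurable_EFinP; exact: mg.
- by move=> s _; rewrite lee_fin mulr_ge0 ?kpow_ge0 ?expR_ge0.
- exact: egamma_ge0.
apply: eq_integral => s _.
have mh : measurable_fun setT (fun u : R =>
    (kpow y s * expR (- s))%:E * (kpow x u * expR (- u))%:E)%E.
  by apply: measurable_funeM; apply/measurable_EFinP; exact: mg.
rewrite -ge0_integralZl//; last 3 first.
- by apply/measurable_EFinP; exact: mg.
- by move=> u _; rewrite lee_fin mulr_ge0 ?kpow_ge0 ?expR_ge0.
- by rewrite lee_fin mulr_ge0 ?kpow_ge0 ?expR_ge0.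
rewrite -(integral_translation (- s) mh).
apply: eq_integral => t _; rewrite /F -EFinM/=; congr (_%:E).
rewrite opprB expRD expRN [expR (- t)]expRN.
by field; rewrite !gt_eqF ?expR_gt0.
Qed.

Lemma continuous_powR (p t : R) : 0 < t -> {for t, continuous (fun u : R => u `^ p)}.
Proof.
move=> t0; apply/differentiable_continuous/derivable1_diffP.
by apply: derivable_powR; rewrite in_itv/= t0.
Qed.

Lemma integral_powR_segment (p a b : R) : 0 < a -> a < b -> p != 0 ->
  (\int[mu]_(t in `[a, b]) (t `^ (p - 1))%:E = ((b `^ p - a `^ p) / p)%:E)%E.
Proof.
move=> a0 ab p0.
have dF (t : R) : 0 < t -> is_derive t 1 (fun t => t `^ p / p) (t `^ (p - 1)).
  move=> t0; have := is_derive1_powR p t0 => h.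
  have -> : (fun t => t `^ p / p) = (fun t => p^-1 *: (t `^ p) : R).
    by apply/funext => u; rewrite /GRing.scale/= mulrC.
  apply: is_derive_eq. by rewrite /GRing.scale/= mulrA mulVf// mul1r.
have cF (t : R) : 0 < t -> {for t, continuous (fun t : R => t `^ p / p)}.
  move=> t0; apply/differentiable_continuous/derivable1_diffP.
  by have [] := dF _ t0.
rewrite (@continuous_FTC2 _ _ (fun t => t `^ p / p))//.
- by rewrite -EFinB mulrBl.
- apply: continuous_in_subspaceT => t /set_mem/=; rewrite in_itv/= => /andP[at_ _].
  by apply: continuous_powR; lra.
- split.
  + move=> u; rewrite in_itv/= => /andP[at_ _].
    by have [] := dF u (lt_trans a0 at_).
  + by apply: cvg_at_right_filter; exact: cF.
  + by apply: cvg_at_left_filter; apply: cF; lra.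
- move=> t; rewrite in_itv/= => /andP[at_ _].
  have [_ <-] := dF t (lt_trans a0 at_).
  by rewrite derive1E.
Qed.

(** The integrand is singular at [0] when [x < 1], so the integral is the limit of
the integrals over [[1/(n+2), 1]], where the fundamental theorem applies. *)
Lemma integral_powR_le (x : R) : 0 < x ->
  (\int[mu]_(t in `]0%R, 1%R]) (t `^ (x - 1))%:E <= (x^-1)%:E)%E.
Proof.
move=> x0.
pose F (n : nat) : set R := `[n.+2%:R^-1, 1]%classic.
have FU : `]0, 1]%classic = \bigcup_n F n.
  apply/seteqP; split => t /=.
    rewrite in_itv/= => /andP[t0 t1].
    have [n nt] : exists n : nat, t^-1 <= n.+2%:R.
      exists (Num.truncn t^-1); rewrite ltW//.
      by rewrite (lt_trans (truncnS_gt _))// ltr_nat.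
    exists n => //; rewrite /F/= in_itv/= t1 andbT.
    by rewrite invf_ple ?posrE.
  move=> [n _]; rewrite /F/= !in_itv/= => /andP[nt ->]; rewrite andbT.
  exact: lt_le_trans nt.
have mf : measurable_fun setT (fun t : R => (t `^ (x - 1))%:E).
  by apply/measurable_EFinP; exact: measurable_powR.
have ndF : nondecreasing_seq F.
  move=> m n mn; rewrite subsetEset => t; rewrite /F/= !in_itv/= => /andP[mt ->].
  rewrite andbT (le_trans _ mt)// lef_pV2 ?posrE ?ler_nat//.
have cv : ((\int[mu]_(t in F i) (t `^ (x - 1))%:E)%E @[i --> \oo] -->
    (\int[mu]_(t in \bigcup_i F i) (t `^ (x - 1))%:E)%E).
  apply: ge0_nondecreasing_set_cvg_integral => //.
  - by move=> i; exact: measurable_itv.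
  - by move=> i; exact: measurable_funTS mf.
  - by move=> i t _; rewrite lee_fin powR_ge0.
rewrite FU -(cvg_lim _ cv)//; apply: lime_le; first by apply/cvg_ex; eexists; exact: cv.
near=> n.
have n0 : (0 : R) < n.+2%:R^-1 by rewrite invr_gt0 ltr0n.
have n1 : (n.+2%:R^-1 : R) < 1 by rewrite invf_lt1 ?ltr1n// ltr0n.
rewrite /F integral_powR_segment ?gt_eqF// powR1 lee_fin.
by rewrite -[leRHS]mul1r ler_pM2r ?invr_gt0// lerBlDr lerDl powR_ge0.
Unshelve. all: end_near. Qed.

Lemma powR_expR_bound (p : R) : exists2 C, 0 <= C &
  forall t, 1 <= t -> t `^ p * expR (- t) <= C * expR (- (t / 2)).
Proof.
pose n := Num.truncn `|p|.
(* one term of the exponential series of [t / 2] dominates [t ^ p] *)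
exists (2 ^+ n.+1 * n.+1`!%:R); first by rewrite mulr_ge0 ?exprn_ge0.
move=> t t1; have t0 : 0 < t by lra.
have -> : expR (- t) = expR (- (t / 2)) * expR (- (t / 2)) by rewrite -expRD; congr expR; lra.
rewrite mulrA ler_pM2r ?expR_gt0//.
rewrite expRN ler_pdivrMr ?expR_gt0//.
apply: (@le_trans _ _ (t `^ (n.+1%:R))).
  apply: ler_powR => //; rewrite (le_trans (ler_norm _))// ltW//; exact: truncnS_gt.
rewrite powR_mulrn ?(ltW t0)//.
have t20 : 0 <= t / 2 by lra.
have := expR_ge1Dxn n t20.
rewrite -(ler_pM2l (_ : 0 < 2 ^+ n.+1 * n.+1`!%:R)); last by rewrite mulr_gt0 ?exprn_gt0// ltr0n fact_gt0.
apply: le_trans; rewrite mulrDr expr_div_n.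
rewrite [X in _ <= _ + X](_ : _ = t ^+ n.+1); last first.
  by field; rewrite !gt_eqF ?exprn_gt0// ltr0n fact_gt0.
by rewrite lerDr mulr1 mulr_ge0 ?exprn_ge0.
Qed.

(** The power is integrable on [0, 1], and beyond [1] the integrand is dominated by
an exponential density of rate [1/2]. *)
Lemma egamma_lty (x : R) : 0 < x -> (egamma x < +oo)%E.
Proof.
move=> x0; have [C C0 hC] := powR_expR_bound (x - 1).
pose g (t : R) : R := ((fun t => t `^ (x - 1)) \_ `]0, 1]) t.
pose h (t : R) := 2 * C * exponential_pdf (2^-1) t.
have mg : measurable_fun setT g.
  by apply/(measurable_restrictT _ _).1 => //; apply: measurable_funTS; exact: measurable_powR.
have me : measurable_fun setT (exponential_pdf (2^-1 : R)).
  exact: measurable_exponential_pdf.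
have mh : measurable_fun setT h by apply: measurable_funM.
have r0 : 0 <= 2^-1 :> R by lra.
have g0 t : 0 <= g t.
  by rewrite /g patchE; case: ifPn => // _; exact: powR_ge0.
have h0 t : 0 <= h t by rewrite mulr_ge0 ?exponential_pdf_ge0//; lra.
apply: (@le_lt_trans _ _ (\int[mu]_t ((g t)%:E + (h t)%:E))%E).
  apply: ge0_le_integral => //.
  - by move=> t _; rewrite lee_fin mulr_ge0 ?kpow_ge0 ?expR_ge0.
  - by apply/measurable_EFinP; exact: measurable_gamma_integrand.
  - by apply: emeasurable_funD; exact/measurable_EFinP.
  - move=> t _; rewrite -EFinD lee_fin.
    have [t0|t0] := leP t 0; first by rewrite /kpow pospart0// mul0r addr_ge0.
    rewrite /kpow pospartE//.
    have [t1|t1] := leP t 1.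
      rewrite -[leLHS]addr0 lerD// /g patchE mem_set/= ?in_itv/= ?t0//.
      by rewrite ler_piMr ?powR_ge0// expR_le1; lra.
    rewrite -[leLHS]add0r lerD// /h exponential_pdfE ?(ltW t0)//.
    rewrite (le_trans (hC _ (ltW t1)))//.
    rewrite (_ : - 2^-1 * t = - (t / 2)); last by field.
    by rewrite (_ : 2 * C * _ = C * expR (- (t / 2))); last by field.
rewrite ge0_integralD//; last 4 first.
- by move=> t _; rewrite lee_fin.
- exact/measurable_EFinP.
- by move=> t _; rewrite lee_fin.
- exact/measurable_EFinP.
apply: lte_add_pinfty.
  rewrite (_ : (\int[mu]_t (g t)%:E = \int[mu]_(t in `]0%R, 1%R]) (t `^ (x - 1))%:E)%E); last first.
    rewrite [RHS]integral_mkcond; apply: eq_integral => t _.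
    by rewrite /g !patchE; case: ifPn.
  by rewrite (le_lt_trans (integral_powR_le x0))// ltry.
under eq_integral do rewrite EFinM.
rewrite ge0_integralZl ?lee_fin//=; last 3 first.
- exact/measurable_EFinP.
- by move=> t _; rewrite lee_fin exponential_pdf_ge0.
- by rewrite mulr_ge0.
rewrite integral_exponential_pdf; last by lra.
by rewrite mule1 ltry.
Qed.

Lemma GammaE (x : R) : 0 < x -> (Gamma x)%:E = egamma x.
Proof.
move=> x0; rewrite Gamma_egamma fineK// ge0_fin_numE ?egamma_lty//.
exact: egamma_ge0.
Qed.

(** Used three times to bound Euler's integrals from below: for positivity, growth,
and the Beta integral. *)
Lemma integral_ge_segment (f : R -> R) (a b c : R) :
  measurable_fun setT f -> (forall t, 0 <= f t) -> 0 <= c -> a < b ->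
  (forall t, a <= t <= b -> c <= f t) ->
  ((c * (b - a))%:E <= \int[mu]_t (f t)%:E)%E.
Proof.
move=> mf f0 c0 ab cf.
have -> : ((c * (b - a))%:E = \int[mu]_(t in `[a, b]) (cst c%:E t))%E.
  by rewrite integral_cst//= lebesgue_measure_itv/= lte_fin ab -EFinB -EFinM.
apply: (@le_trans _ _ (\int[mu]_(t in `[a, b]) (f t)%:E)%E).
  apply: ge0_le_integral => //.
  - by apply/measurable_EFinP; exact: measurable_funTS.
by apply: ge0_subset_integral => //; [exact/measurable_EFinP|move=> t _; rewrite lee_fin].
Qed.

Lemma Gamma_gt0 (x : R) : 0 < x -> 0 < Gamma x.
Proof.
move=> x0; rewrite -lte_fin GammaE//.
pose c := (2 `^ `|x - 1|)^-1 * expR (- 2) : R.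
have c0 : 0 < c by rewrite mulr_gt0 ?expR_gt0// invr_gt0 powR_gt0.
have := @integral_ge_segment (fun t => kpow x t * expR (- t)) 1 2 c.
rewrite -/(egamma x) => h; apply: (lt_le_trans _ (h _ _ _ _ _)).
- by rewrite lte_fin mulr_gt0//; lra.
- exact: measurable_gamma_integrand.
- by move=> t; rewrite mulr_ge0 ?kpow_ge0 ?expR_ge0.
- exact: ltW.
- lra.
- move=> t /andP[t1 t2]; rewrite /kpow pospartE; last lra.
  apply: ler_pM; rewrite ?expR_ge0 ?invr_ge0 ?powR_ge0//; last by rewrite ler_expR; lra.
  apply: (@le_trans _ _ (t `^ (- `|x - 1|))).
    rewrite powRN lef_pV2 ?posrE ?powR_gt0//; last lra.
    by apply: ge0_ler_powR; rewrite ?nnegrE//; lra.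
  by apply: ler_powR => //; rewrite lerNl ler_normr lexx orbT.
Qed.

(** Integrate over [[M, M + 1]] only; as [M] is arbitrary, Gamma beats every
exponential. *)
Lemma Gamma_growth (M x : R) : 1 <= M -> 1 <= x ->
  M `^ (x - 1) * expR (- (M + 1)) <= Gamma x.
Proof.
move=> M1 x1; rewrite -lee_fin GammaE; last lra.
have -> : M `^ (x - 1) * expR (- (M + 1)) = M `^ (x - 1) * expR (- (M + 1)) * (M + 1 - M) by ring.
apply: (@integral_ge_segment (fun t => kpow x t * expR (- t))).
- exact: measurable_gamma_integrand.
- by move=> t; rewrite mulr_ge0 ?kpow_ge0 ?expR_ge0.
- by rewrite mulr_ge0 ?powR_ge0 ?expR_ge0.
- lra.
- move=> t /andP[t1 t2]; rewrite /kpow pospartE; last lra.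
  apply: ler_pM; rewrite ?expR_ge0 ?powR_ge0//; last by rewrite ler_expR; lra.
  by apply: ge0_ler_powR; rewrite ?nnegrE//; lra.
Qed.

Lemma kconv1E (x y : R) : 0 < x -> 0 < y ->
  kconv x y 1 = (Gamma x * Gamma y / Gamma (x + y))%:E.
Proof.
move=> x0 y0; have xy0 : 0 < x + y by lra.
have := egamma_beta x y; rewrite -!GammaE// => h.
have G0 := Gamma_gt0 xy0.
rewrite EFinM EFinM h [RHS]muleC muleA -EFinM mulVf ?gt_eqF//.
by rewrite mul1e.
Qed.

Lemma kconv_Gamma (x y t : R) : 0 < x -> 0 < y ->
  kconv x y t = (Gamma x * Gamma y / Gamma (x + y) * kpow (x + y) t)%:E.
Proof. by move=> x0 y0; rewrite kconvE kconv1E// -EFinM mulrC. Qed.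

(** Lower bound of both factors of the Beta integrand on [[1/4, 3/4]]. *)
Lemma powR_middle_ge (z t : R) : 0 < z -> 1 / 4 <= t <= 3 / 4 ->
  (4 `^ z)^-1 <= kpow z t.
Proof.
move=> z0 /andP[t1 t2]; have t0 : 0 < t by lra.
rewrite /kpow pospartE//; apply: (@le_trans _ _ (t `^ z)); last first.
  by apply: ger_powR; [apply/andP; split; lra|rewrite gerBl].
rewrite (_ : (4 `^ z)^-1 = (1 / 4) `^ z).
  by apply: ge0_ler_powR; rewrite ?nnegrE//; [exact: ltW|exact: ltW].
by rewrite mul1r -[4^-1]powR_inv1// -powRrM mulN1r powRN.
Qed.

(** The middle half of [0, 1] already contributes [4^-(x+y) / 2] to the Beta
integral [Gamma x * Gamma y / Gamma (x + y)]. *)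
Lemma invGammaM_le (x y : R) : 0 < x -> 0 < y ->
  (Gamma x * Gamma y)^-1 <= 2 * 4 `^ (x + y) / Gamma (x + y).
Proof.
have q : (1 / 4 : R) < 3 / 4 by lra.
move=> x0 y0; have xy0 : 0 < x + y by rewrite addr_gt0.
have p4 : 0 < (4 : R) `^ (x + y) by rewrite powR_gt0.
have h : (4 `^ (x + y))^-1 / 2 <= Gamma x * Gamma y / Gamma (x + y).
  rewrite -lee_fin -kconv1E//.
  have -> : (4 `^ (x + y))^-1 / 2 = (4 `^ (x + y))^-1 * (3 / 4 - 1 / 4).
    by congr (_ * _); field.
  apply: (@integral_ge_segment (fun s => kpow x (1 - s) * kpow y s)).
  - apply: measurable_funM; last exact: measurable_kpow.
    by apply: measurable_translate_rev; exact: measurable_kpow.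
  - by move=> t; rewrite mulr_ge0 ?kpow_ge0.
  - by rewrite invr_ge0 ltW.
  - exact: q.
  - move=> t t14; rewrite powRD; last by rewrite pnatr_eq0 implybT.
    rewrite invfM; apply: ler_pM; rewrite ?invr_ge0 ?powR_ge0//.
      by apply: powR_middle_ge => //; move: t14 => {p4} /andP[t1 t2]; lra.
    exact: powR_middle_ge.
have := mulr_gt0 (Gamma_gt0 x0) (Gamma_gt0 y0); have := Gamma_gt0 xy0.
move: h p4; move: (Gamma x * Gamma y) (Gamma (x + y)) (4 `^ (x + y)) => a c p.
move=> h p0 c0 a0; rewrite -div1r ler_pdivrMr// mulrAC -mulrA.
have : (p^-1 / 2) * (2 * p) <= a / c * (2 * p) by rewrite ler_pM2r// mulr_gt0.
rewrite (_ : (p^-1 / 2) * (2 * p) = 1); last by field; rewrite gt_eqF.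
by rewrite mulrC [a / c]mulrC mulrA.
Qed.

Lemma Gamma1 : Gamma 1 = 1 :> R.
Proof.
have h : (\int[mu]_x (exponential_pdf 1 x)%:E = (1 : R)%:E)%E.
  by rewrite integral_exponential_pdf.
apply: EFin_inj; rewrite GammaE// -h.
transitivity (\int[mu]_(t in `]0%R, +oo[) (expR (- t))%:E)%E.
  rewrite [RHS]integral_mkcond; apply: eq_integral => t _.
  rewrite /kpow /pospart !patchE; case: ifPn => _; last by rewrite mul0r.
  by rewrite subrr powRr0 mul1r.
rewrite integral_itv_obnd_cbnd; last first.
  apply/measurable_EFinP/measurable_funTS.
  by apply: measurableT_comp => //; exact: measurable_expR.
rewrite integral_mkcond; apply: eq_integral => t _.
by rewrite /exponential_pdf !patchE; case: ifPn => // _; rewrite mul1r mulN1r.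
Qed.

Lemma kconv1_segment (x t : R) :
  kconv 1 x t = (\int[mu]_(s in `]0%R, t[) (s `^ (x - 1))%:E)%E.
Proof.
rewrite [RHS]integral_mkcond; apply: eq_integral => s _; rewrite patchE.
case: ifPn => [/set_mem|/negP].
  rewrite /= in_itv/= => /andP[s0 st]; rewrite /kpow !pospartE ?subr_gt0//.
  by rewrite subrr powRr0 mul1r.
have [s0|s0] := leP s 0; first by rewrite [kpow x s]pospart0 ?mulr0.
have [st|st] := leP t s; first by rewrite [kpow 1 _]pospart0 ?mul0r// subr_le0.
by case; rewrite inE/= in_itv/= s0.
Qed.

(** Instead of an integration by parts at two singular ends, use the Beta identity
with first argument [1]: it evaluates the integral of [s^(x-1)] over [0, t] as a
multiple of [t^x], and the difference between [t = 2] and [t = 1] is elementary. *)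
Lemma GammaS (x : R) : 0 < x -> Gamma (x + 1) = x * Gamma x.
Proof.
move=> x0; have x1 : 0 < 1 + x by lra.
have Gx := Gamma_gt0 x0; have Gx1 := Gamma_gt0 x1.
have mp (D : set R) : measurable_fun D (fun s : R => (s `^ (x - 1))%:E).
  by apply/measurable_EFinP; apply: measurable_funTS; exact: measurable_powR.
have : kconv 1 x 2 = (kconv 1 x 1 + ((2 `^ x - 1 `^ x) / x)%:E)%E.
  rewrite !kconv1_segment -integral_powR_segment ?gt_eqF//; last lra.
  rewrite -integral_itv_bndo_bndc//.
  rewrite -ge0_integral_setU//=; last 3 first.
  - exact: mp.
  - by move=> s _; rewrite lee_fin powR_ge0.
  - apply/disj_setPRL => s /=; rewrite !in_itv/= => /andP[s0 s1] /andP[_].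
    by rewrite ltNge s0.
  congr (integral _ _ _); apply/seteqP; split => s /=; rewrite !in_itv/=.
    move=> /andP[s0 s2]; have [s1|s1] := ltP s 1; first by left; rewrite s0.
    by right; rewrite ?s1 s2.
  move=> [/andP[-> s1]|/andP[s1 ->]]; last by rewrite (lt_le_trans _ s1).
  by rewrite (lt_trans s1)// ltr1n.
rewrite !kconv_Gamma// /kpow !pospartE// Gamma1 !powR1 addrAC subrr add0r.
rewrite -EFinD => -[]; rewrite mul1r mulr1 => /eqP.
set r := Gamma x / _; rewrite -subr_eq0 => /eqP h.
have p2 : 2 `^ x - 1 != 0.
  by rewrite subr_eq0 powR_eq1; apply/negP; lra.
have rx : r = x^-1.
  apply: (mulIf p2); apply/eqP; rewrite -subr_eq0 -[X in _ == X]h; apply/eqP; ring.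
have : Gamma x = r * Gamma (1 + x) by rewrite /r divfK// gt_eqF.
by rewrite addrC => ->; rewrite rx mulVKf// gt_eqF.
Qed.

End Gamma_facts.

(** * Exponentially bounded sequences and their convolution *)

Section Sequences.
Context {R : realType}.
Implicit Types u v r : R^nat.

Definition expbounded u := exists K A : R, forall k, `|u k| <= K * A ^+ k.

(** The constants can be enlarged at will, which lets several sequences share them
and yields the lower bounds imposed on [K] and [A] in the theorem. *)
Lemma expboundedP u (K0 A0 : R) : expbounded u ->
  exists K A, [/\ K0 <= K, A0 <= A, 0 < K, 1 <= A & forall k, `|u k| <= K * A ^+ k].
Proof.
move=> [K [A uKA]].
exists (Num.max (Num.max K0 1) `|K|), (Num.max (Num.max A0 1) `|A|).
have K1 : 0 < Num.max (Num.max K0 1) `|K| by rewrite !lt_max ltr01 orbT.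
have A1 : 1 <= Num.max (Num.max A0 1) `|A| by rewrite !le_max lexx orbT.
split; rewrite ?K1 ?A1// ?le_max ?lexx//= => k.
apply: (le_trans (uKA k)); apply: (le_trans (ler_norm _)).
rewrite normrM normrX; apply: ler_pM; rewrite ?exprn_ge0//.
  by rewrite le_max lexx orbT.
by apply: lerXn2r; rewrite ?nnegrE ?(le_trans ler01 A1)// le_max lexx orbT.
Qed.

Lemma expbounded2P u v : expbounded u -> expbounded v ->
  exists K A, [/\ 0 < K, 1 <= A, forall k, `|u k| <= K * A ^+ k &
                  forall k, `|v k| <= K * A ^+ k].
Proof.
move=> /(expboundedP 0 0)[K [A [_ _ K0 A1 uKA]]].
move=> /(expboundedP K A)[L [B [KL AB L0 B1 vLB]]].
exists L, B; split=> // k; apply: (le_trans (uKA k)).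
apply: ler_pM => //; [exact: ltW|by rewrite exprn_ge0// (le_trans ler01)|].
by apply: lerXn2r; rewrite // nnegrE (le_trans ler01).
Qed.

Lemma expbounded_conv u v : expbounded u -> expbounded v -> expbounded (seqconv u v).
Proof.
move=> eu ev; have [K [A [K0 A1 uK vK]]] := expbounded2P eu ev.
exists (K * K), (2 * A) => k; rewrite /seqconv.
apply: (le_trans (ler_norm_sum _ _ _)).
apply: (@le_trans _ _ (\sum_(0 <= l < k.+1) K * K * A ^+ k)).
  apply: ler_sum_nat => l /andP[_ lk]; rewrite normrM.
  rewrite (_ : K * K * A ^+ k = (K * A ^+ l) * (K * A ^+ (k - l))).
    by apply: ler_pM.
  by rewrite -{1}(subnKC (lk : (l <= k)%N)) exprD; ring.
rewrite sumr_const_nat subn0 -[_ *+ k.+1]mulr_natr exprMn -mulrA ler_pM2l ?mulr_gt0//.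
rewrite mulrC ler_pM2r; last by rewrite exprn_gt0// (lt_le_trans ltr01).
by rewrite -natrX ler_nat ltn_expl.
Qed.

Lemma expboundedZ u (x y : R) : expbounded u -> expbounded (fun k => y * x ^+ k * u k).
Proof.
move=> [K [A uKA]]; exists (`|y| * K), (`|x| * A) => k.
rewrite !normrM normrX exprMn.
rewrite (_ : _ * K * _ = `|y| * `|x| ^+ k * (K * A ^+ k)); last ring.
by rewrite ler_wpM2l// mulr_ge0 ?exprn_ge0.
Qed.

Lemma seqconv_recl u v k :
  seqconv u v k = u 0%N * v k + \sum_(1 <= l < k.+1) u l * v (k - l)%N.
Proof. by rewrite /seqconv big_nat_recl//= subn0 [in RHS]big_add1. Qed.

Lemma seqconvX u v (a b x : R) k :
  seqconv (fun i => a * x ^+ i * u i) (fun i => b * x ^+ i * v i) k =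
  a * b * x ^+ k * seqconv u v k.
Proof.
rewrite /seqconv mulr_sumr; apply: eq_big_nat => l /andP[_ lk].
by rewrite -{3}(subnKC (lk : (l <= k)%N)) exprD; ring.
Qed.

(** The finite geometric sum, in the form in which it appears in the convolution
recursion. *)
Lemma geometric_convolution (A B : R) k :
  (A - B) * (\sum_(1 <= l < k.+1) B ^+ l * A ^+ (k - l)) = B * (A ^+ k - B ^+ k).
Proof.
rewrite big_add1/= big_mkord subrXX [RHS]mulrCA; congr (_ * _).
rewrite mulr_sumr.
by apply: eq_bigr => i _; rewrite exprS subnS -subn1 subnAC subn1 [_.-1]/=; ring.
Qed.

(** By induction on [k] in [u_0 v_k = (u conv v)_k - sum_(l >= 1) u_l v_(k-l)].  If
[u] and [u conv v] grow like [B^k], choose the rate [A] of [v] so much larger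
than [B] that the sum costs only half of the bound aimed at, and the leading
constant so large that [u conv v] costs the other half. *)
Lemma expbounded_div u v : u 0%N != 0 -> expbounded u ->
  expbounded (seqconv u v) -> expbounded v.
Proof.
move=> u0 eu er; have [K [B [K0 B1 uK rK]]] := expbounded2P eu er.
pose c := `|u 0%N|; have c0 : 0 < c by rewrite normr_gt0.
pose A := B * (1 + 2 * K / c).
have B0 : 0 < B by rewrite (lt_le_trans ltr01).
have AB : B <= A by rewrite ler_peMr ?(ltW B0)// lerDl !mulr_ge0 ?invr_ge0 ?ltW.
have A0 : 0 < A by exact: lt_le_trans AB.
have ABE : A - B = 2 * K * B / c by rewrite /A; ring.
have AB0 : 0 < A - B by rewrite ABE !mulr_gt0 ?invr_gt0.
exists (2 * K / c), A; elim/ltn_ind => k IH.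
rewrite -(ler_pM2l c0) -normrM.
have -> : u 0%N * v k = seqconv u v k - \sum_(1 <= l < k.+1) u l * v (k - l)%N.
  by rewrite seqconv_recl addrK.
apply: (le_trans (ler_normB _ _)).
rewrite (_ : c * _ = K * A ^+ k + K * A ^+ k); last by field; rewrite gt_eqF.
apply: lerD.
  apply: (le_trans (rK k)); rewrite ler_pM2l//.
  by apply: lerXn2r; rewrite // nnegrE ltW.
apply: (le_trans (ler_norm_sum _ _ _)).
apply: (@le_trans _ _ (\sum_(1 <= l < k.+1) K * (2 * K / c) * (B ^+ l * A ^+ (k - l)))).
  apply: ler_sum_nat => l /andP[l1 lk]; rewrite normrM.
  rewrite (_ : K * (2 * K / c) * _ = (K * B ^+ l) * (2 * K / c * A ^+ (k - l))); last ring.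
  by apply: ler_pM => //; apply: IH; rewrite ltn_subrL l1 (leq_trans l1 lk).
rewrite -mulr_sumr -mulrA ler_pM2l//.
rewrite -(ler_pM2l AB0) mulrCA geometric_convolution ABE.
rewrite (_ : 2 * K / c * (B * _) = 2 * K * B / c * (A ^+ k - B ^+ k)); last by field; rewrite gt_eqF.
by rewrite -ABE ler_pM2l// gerBl exprn_ge0// ltW.
Qed.

(** Convolution equations are solved one coefficient at a time; the list [p n]
holds the first [n] coefficients. *)
Lemma seqconv_solve u r : u 0%N != 0 -> exists v, seqconv u v = r.
Proof.
move=> u0.
pose step (s : seq R) := rcons s
  ((r (size s) - \sum_(1 <= l < (size s).+1) u l * s`_(size s - l)) / u 0%N).
pose p n := iter n step [::].
have sp n : size (p n) = n by elim: n => //= n IH; rewrite size_rcons IH.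
have pE m j : (j < m)%N -> (p m)`_j = (p j.+1)`_j.
  elim: m => // m IH; rewrite ltnS leq_eqVlt => /predU1P[->//|jm].
  by rewrite -IH//= nth_rcons sp jm.
exists (fun n => (p n.+1)`_n); apply/funext => k.
rewrite seqconv_recl.
have -> : \sum_(1 <= l < k.+1) u l * (p (k - l).+1)`_(k - l) =
    \sum_(1 <= l < k.+1) u l * (p k)`_(k - l).
  apply: eq_big_nat => l /andP[l1 lk]; rewrite [in RHS]pE//.
  by rewrite ltn_subrL l1 (leq_trans l1 lk).
by rewrite /= nth_rcons sp ltnn eqxx mulrCA divff// mulr1 subrK.
Qed.

End Sequences.

(** * Cauchy products *)

Section CauchyProduct.
Context {R : realType}.
Implicit Types u v : R^nat.

(** Summation over the triangle [i + j < n], row by row. *)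
Lemma series_seqconv u v n :
  series (seqconv u v) n = \sum_(0 <= i < n) u i * series v (n - i)%N.
Proof.
elim: n => [|n IH]; first by rewrite /series/= !big_geq.
rewrite seriesSr IH [RHS]big_nat_recr//= subSnn.
have -> : \sum_(0 <= i < n) u i * series v (n.+1 - i)%N =
   \sum_(0 <= i < n) u i * series v (n - i)%N + \sum_(0 <= i < n) u i * v (n - i)%N.
  rewrite -big_split; apply: eq_big_nat => i /andP[_ /ltnW i_n] /=.
  by rewrite subSn// seriesSr mulrDr.
by rewrite -addrA; congr (_ + _); rewrite /seqconv big_nat_recr//= subnn /series/= big_nat1.
Qed.

Definition absseq u : R^nat := fun k => `|u k|.

Lemma norm_seqconv_le u v k : `|seqconv u v k| <= seqconv (absseq u) (absseq v) k.
Proof.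
apply: (le_trans (ler_norm_sum _ _ _)).
by apply: ler_sum_nat => l _; rewrite normrM.
Qed.

Lemma nd_series u : (forall k, 0 <= u k) -> {homo series u : m n / (m <= n)%N >-> m <= n}.
Proof.
move=> u0 m n mn; rewrite -subr_ge0 sub_series_geq// sumr_ge0//.
Qed.

Lemma series_seqconv_le u v n : (forall k, 0 <= u k) -> (forall k, 0 <= v k) ->
  series (seqconv u v) n <= series u n * series v n.
Proof.
move=> u0 v0; rewrite series_seqconv {2}/series/= mulr_suml.
apply: ler_sum_nat => i _; rewrite ler_wpM2l//.
by apply: nd_series; rewrite ?leq_subr.
Qed.

Lemma series_seqconv_ge u v m n : (forall k, 0 <= u k) -> (forall k, 0 <= v k) ->
  (m.*2 <= n)%N -> series u m * series v m <= series (seqconv u v) n.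
Proof.
move=> u0 v0 mn; rewrite series_seqconv {1}/series/= mulr_suml.
have mn' : (m <= n)%N by rewrite (leq_trans _ mn)// -addnn leq_addr.
rewrite [leRHS](big_cat_nat _ mn')//= -[leLHS]addr0 lerD//.
  apply: ler_sum_nat => i /andP[_ im]; rewrite ler_wpM2l//.
  apply: nd_series => //; rewrite leq_subRL ?(leq_trans (ltnW im))//.
  by rewrite (leq_trans _ mn)// -addnn leq_add2r ltnW.
rewrite sumr_ge0// => i _; rewrite mulr_ge0//.
by rewrite (le_trans _ (nd_series v0 (leq0n _)))// /series/= big_geq.
Qed.

(** The triangle [i + j < n] contains the square of side [n/2] and is contained in
the square of side [n]; for the series of absolute values the partial sums over
both squares have the same limit, so the terms between them are negligible. *)
Lemma cvg_cauchy_product u v : cvgn (series (absseq u)) -> cvgn (series (absseq v)) ->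
  series (seqconv u v) @ \oo --> limn (series u) * limn (series v).
Proof.
move=> cu cv.
have cu' : cvgn (series u) by exact: normed_cvg.
have cv' : cvgn (series v) by exact: normed_cvg.
have nu k : 0 <= absseq u k by rewrite /absseq.
have nv k : 0 <= absseq v k by rewrite /absseq.
pose P n := series (absseq u) n * series (absseq v) n.
have cP : P @ \oo --> limn (series (absseq u)) * limn (series (absseq v)).
  exact: cvgM.
have half : (fun n => n./2) @ \oo --> \oo.
  apply/cvgnyPge => M; near=> n.
  rewrite -(doubleK M) half_leq//; near: n; exact: nbhs_infty_ge.
have cPh : (fun n => P n./2) @ \oo --> limn (series (absseq u)) * limn (series (absseq v)).
  exact: (cvg_comp _ _ half cP).
have c0 : (fun n => P n - P n./2) @ \oo --> (0 : R).
  by rewrite -(subrr (limn (series (absseq u)) * limn (series (absseq v)))); exact: cvgB.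
have bd n : `|series u n * series v n - series (seqconv u v) n| <= P n - P n./2.
  apply: (@le_trans _ _ (P n - series (seqconv (absseq u) (absseq v)) n)).
    rewrite !series_seqconv {1 3}/series/= /P {1}/series/= !mulr_suml -!sumrB.
    apply: (le_trans (ler_norm_sum _ _ _)); apply: ler_sum_nat => i /andP[_ i_n].
    rewrite -!mulrBr normrM ler_wpM2l//.
    by rewrite !sub_series_geq ?leq_subr// ler_norm_sum.
  rewrite lerB//; apply: series_seqconv_ge => //.
  by rewrite -[leqRHS](odd_double_half n) leq_addl.
have c1 : (fun n => series u n * series v n - series (seqconv u v) n) @ \oo --> (0 : R).
  apply/norm_cvg0P; apply: (squeeze_cvgr _ (cvg_cst 0) c0).
  by apply: nearW => n; rewrite normr_ge0 bd.
have -> : series (seqconv u v) = (fun n => series u n * series v n -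
    (series u n * series v n - series (seqconv u v) n)).
  by apply/funext => n; rewrite opprB addrC subrK.
rewrite -[X in _ --> X]subr0; apply: cvgB => //.
exact: cvgM.
Unshelve. all: end_near. Qed.

(** A bound uniform in [n], as needed for dominated convergence. *)
Lemma norm_series_seqconv_le u v n :
  cvgn (series (absseq u)) -> cvgn (series (absseq v)) ->
  `|series (seqconv u v) n| <= limn (series (absseq u)) * limn (series (absseq v)).
Proof.
move=> cu cv; have nu k : 0 <= absseq u k by rewrite /absseq.
have nv k : 0 <= absseq v k by rewrite /absseq.
apply: (@le_trans _ _ (series (seqconv (absseq u) (absseq v)) n)).
  apply: (le_trans (ler_norm_sum _ _ _)); apply: ler_sum_nat => i _.
  exact: norm_seqconv_le.
apply: (le_trans (series_seqconv_le _ nu nv)).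
have s0 w m : 0 <= series (absseq w) m by rewrite /series/= sumr_ge0// => i _; rewrite /absseq.
by apply: ler_pM => //; apply: nondecreasing_cvgn_le => //; exact: nd_series.
Qed.

End CauchyProduct.

(* From here on, only the identities and bounds above are used; unfolding the
   integral would only slow down unification. *)
Local Opaque Gamma.

(** * Fractional power series and their convolution *)

Section PowerConvolution.
Context {R : realType}.
Local Notation mu := (@lebesgue_measure R).

Lemma kconv_itv (x y t : R) :
  kconv x y t = (\int[mu]_(s in `]0%R, t[) ((t - s) `^ (x - 1) * s `^ (y - 1))%:E)%E.
Proof.
rewrite [RHS]integral_mkcond; apply: eq_integral => s _; rewrite patchE.
case: ifPn => [/set_mem|/negP].
  by rewrite /= in_itv/= => /andP[s0 st]; rewrite /kpow !pospartE ?subr_gt0.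
have [s0|s0] := leP s 0; first by rewrite [kpow y s]pospart0 ?mulr0.
have [st|st] := leP t s; first by rewrite [kpow x _]pospart0 ?mul0r// subr_le0.
by case; rewrite inE/= in_itv/= s0.
Qed.

Lemma measurable_powR_conv (x y t : R) (D : set R) :
  measurable_fun D (fun s : R => (t - s) `^ (x - 1) * s `^ (y - 1)).
Proof.
apply: measurable_funTS; apply: measurable_funM; last exact: measurable_powR.
by apply: (@measurable_translate_rev _ t (fun u => u `^ (x - 1))); exact: measurable_powR.
Qed.

Lemma integral_powR_conv (x y t : R) : 0 < x -> 0 < y -> 0 < t ->
  (\int[mu]_(s in `]0%R, t[) ((t - s) `^ (x - 1) * s `^ (y - 1))%:E =
   (Gamma x * Gamma y / Gamma (x + y) * t `^ (x + y - 1))%:E)%E.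
Proof. by move=> x0 y0 t0; rewrite -kconv_itv kconv_Gamma// /kpow pospartE. Qed.

Lemma integrable_powR_conv (x y t : R) : 0 < x -> 0 < y -> 0 < t ->
  mu.-integrable `]0, t[ (fun s : R => ((t - s) `^ (x - 1) * s `^ (y - 1))%:E).
Proof.
move=> x0 y0 t0; apply/integrableP; split.
  by apply/measurable_EFinP; exact: measurable_powR_conv.
under eq_integral do rewrite gee0_abs ?lee_fin ?mulr_ge0 ?powR_ge0//.
by rewrite integral_powR_conv// ltry.
Qed.

Lemma integrable_powR_convZ (c x y t : R) : 0 < x -> 0 < y -> 0 < t ->
  mu.-integrable `]0, t[ (fun s : R => (c * ((t - s) `^ (x - 1) * s `^ (y - 1)))%:E).
Proof.
move=> x0 y0 t0.
have := @integrableZl _ (measurableTypeR R) R mu _ (measurable_itv _) c _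
  (integrable_powR_conv x0 y0 t0).
by apply: eq_integrable => // s _; rewrite -EFinM.
Qed.

End PowerConvolution.

Section FractionalSeries.
Context {R : realType} (alpha : R).
Hypothesis alpha0 : 0 < alpha.
Local Notation mu := (@lebesgue_measure R).
Implicit Types (u v : R^nat) (beta gamma : R).

(** The coefficients of the power series in [t^alpha] that is left when
[t^(beta - 1)] is factored out of [phi_(beta,u)]. *)
Definition fcoef beta u : R^nat := fun k => u k / Gamma (beta + alpha * k%:R).

Definition fterm beta u (x : R) : R^nat := fun k => fcoef beta u k * x ^+ k.

Definition fsum beta u (x : R) : R := limn (pseries (fcoef beta u) x).

Definition fracseries beta u (t : R) : R := t `^ (beta - 1) * fsum beta u (t `^ alpha).

Lemma fidx_gt0 beta (k : nat) : 0 < beta -> 0 < beta + alpha * k%:R.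
Proof. by move=> b0; rewrite ltr_wpDr// mulr_ge0// ltW. Qed.

(** [Gamma_growth] with [M^alpha = 4 B].  It is applied to
[y * Gamma y = Gamma (y + 1)], because [y = beta + alpha k] may be smaller than
[1]; the factor [y] is absorbed by one of the two powers of [2] to spare. *)
Lemma invGamma_decay beta (B : R) : 0 < beta -> 1 <= B ->
  exists C : R, forall k, B ^+ k / Gamma (beta + alpha * k%:R) <= C / 2 ^+ k.
Proof.
move=> b0 B1; pose D := 4 * B; have D1 : 1 <= D by rewrite /D; lra.
have D0 : 0 < D by exact: lt_le_trans D1.
pose M := D `^ alpha^-1.
have M1 : 1 <= M by rewrite -(powRr0 D) ler_powR// invr_ge0 ltW.
have M0 : 0 < M by exact: lt_le_trans M1.
have MD k : M `^ (alpha * k%:R) = D ^+ k.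
  by rewrite /M -powRrM mulrA mulVf ?gt_eqF// mul1r powR_mulrn// ltW.
exists ((beta + alpha) * expR (M + 1) / M `^ beta) => k.
have y0 := fidx_gt0 k b0; set y := beta + alpha * k%:R in y0 *.
have Gy := Gamma_gt0 y0.
have h : M `^ beta * D ^+ k * expR (- (M + 1)) <= y * Gamma y.
  rewrite -(GammaS y0).
  have := @Gamma_growth _ M (y + 1) M1; rewrite lerDr => /(_ (ltW y0)).
  by rewrite addrK /y powRD ?MD// (gt_eqF M0) implybT.
have yk : y <= (beta + alpha) * 2 ^+ k.
  rewrite /y mulrDl lerD//; first by rewrite ler_peMr ?(ltW b0)// exprn_ege1// ler1n.
  by rewrite ler_pM2l// -natrX ler_nat ltnW// ltn_expl.
have Mb : 0 < M `^ beta by rewrite powR_gt0.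
rewrite ler_pdivrMr//.
rewrite -(ler_pM2l (_ : 0 < y)) //.
have e0 := expR_gt0 (M + 1).
apply: (@le_trans _ _ ((beta + alpha) * expR (M + 1) / M `^ beta / 2 ^+ k *
    (M `^ beta * D ^+ k * expR (- (M + 1))))); last first.
  rewrite [leRHS]mulrCA ler_pM2l// !mulr_gt0 ?invr_gt0 ?exprn_gt0//; exact: addr_gt0.
rewrite expRN.
rewrite (_ : _ * (_ * _ * _) = (beta + alpha) * (D ^+ k / 2 ^+ k)); last first.
  by field; rewrite !gt_eqF ?exprn_gt0.
rewrite -expr_div_n (_ : D / 2 = 2 * B); last by rewrite /D; field.
rewrite exprMn mulrA ler_pM2r//; by rewrite exprn_gt0// (lt_le_trans ltr01).
Qed.

Lemma cvg_fterm_norm beta u (x : R) : 0 < beta -> expbounded u ->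
  cvgn (series (absseq (fterm beta u x))).
Proof.
move=> b0 /(expboundedP 0 0)[K [A [_ _ K0 A1 uKA]]].
have B1 : 1 <= Num.max 1 (A * `|x|) by rewrite le_max lexx.
set B := Num.max _ _ in B1; have [C hC] := invGamma_decay b0 B1.
have Gk k := Gamma_gt0 (fidx_gt0 k b0).
have C0 : 0 <= C.
  have := hC 0%N; rewrite !expr0 divr1; apply: le_trans.
  by rewrite mul1r invr_ge0 ltW.
apply: (@series_le_cvg _ _ (geometric (K * C) (2^-1))).
- by move=> n; rewrite /absseq.
- by move=> n /=; rewrite mulr_ge0 ?exprn_ge0 ?mulr_ge0 ?(ltW K0)// invr_ge0.
- move=> n; rewrite /absseq /fterm /fcoef /= !normrM normfV normrX [`|Gamma _|]gtr0_norm//.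
  apply: (@le_trans _ _ (K * A ^+ n / Gamma (beta + alpha * n%:R) * `|x| ^+ n)).
    by rewrite ler_wpM2r ?exprn_ge0// ler_wpM2r// invr_ge0 ltW.
  rewrite (_ : _ * `|x| ^+ n = K * ((A * `|x|) ^+ n / Gamma (beta + alpha * n%:R))); last first.
    by rewrite exprMn; ring.
  rewrite -mulrA ler_pM2l// exprVn; apply: le_trans (hC n).
  rewrite ler_wpM2r ?invr_ge0 ?(ltW (Gk n))//.
  apply: lerXn2r; rewrite ?nnegrE ?mulr_ge0 ?(le_trans ler01 A1) ?(le_trans ler01 B1)//.
  by rewrite /B le_max lexx orbT.
- by apply: is_cvg_geometric_series; rewrite ger0_norm ?invr_ge0// invf_lt1// ltr1n.
Qed.

Lemma cvg_pseries_fcoef beta u (x : R) : 0 < beta -> expbounded u ->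
  cvgn (pseries (fcoef beta u) x).
Proof. by move=> b0 eu; apply: normed_cvg; exact: (@cvg_fterm_norm _ _ x b0 eu). Qed.

Lemma fsumE beta u (x : R) : fsum beta u x = limn (series (fterm beta u x)).
Proof. by []. Qed.

Lemma expbounded_diffs u : expbounded u -> expbounded (fun k => k.+1%:R * u k.+1).
Proof.
move=> /(expboundedP 0 0)[K [A [_ _ K0 A1 uKA]]].
exists (K * A), (2 * A) => k; rewrite normrM ger0_norm//.
apply: (@le_trans _ _ (2 ^+ k * (K * A ^+ k.+1))).
  by apply: ler_pM => //; rewrite -natrX ler_nat ltn_expl.
by rewrite exprMn exprS le_eqVlt; apply/orP; left; apply/eqP; ring.
Qed.

Lemma pseries_diffs_fcoef beta u :
  pseries_diffs (fcoef beta u) = fcoef (beta + alpha) (fun k => k.+1%:R * u k.+1).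
Proof.
apply/funext => k; rewrite /pseries_diffs /fcoef mulrA.
by congr (_ / Gamma _); rewrite -natr1; ring.
Qed.

(** Termwise differentiation shifts [beta] by [alpha]. *)
Lemma is_derive_fsum beta u (x : R) : 0 < beta -> expbounded u ->
  is_derive x 1 (fsum beta u) (fsum (beta + alpha) (fun k => k.+1%:R * u k.+1) x).
Proof.
move=> b0 eu; have b1 : 0 < beta + alpha by rewrite addr_gt0.
have b2 : 0 < beta + alpha + alpha by rewrite addr_gt0.
have e1 := expbounded_diffs eu; have e2 := expbounded_diffs e1.
rewrite /fsum -pseries_diffs_fcoef; apply: (@pseries_snd_diffs _ _ (`|x| + 1)).
- exact: cvg_pseries_fcoef.
- by rewrite pseries_diffs_fcoef; exact: cvg_pseries_fcoef.
- by rewrite !pseries_diffs_fcoef; exact: cvg_pseries_fcoef.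
- by rewrite [X in _ < X]ger0_norm ?ltrDl// addr_ge0.
Qed.

Lemma continuous_fsum beta u : 0 < beta -> expbounded u -> continuous (fsum beta u).
Proof.
move=> b0 eu x; apply/differentiable_continuous/derivable1_diffP.
by have [] := is_derive_fsum x b0 eu.
Qed.

Lemma measurable_fracseries beta u : 0 < beta -> expbounded u ->
  measurable_fun setT (fracseries beta u).
Proof.
move=> b0 eu; apply: measurable_funM; first exact: measurable_powR.
apply: measurableT_comp; last exact: measurable_powR.
by apply: continuous_measurable_fun; exact: continuous_fsum.
Qed.

(** The majorant series, which bounds the partial sums for all arguments of modulus
at most [x]. *)
Definition fmajor beta u (x : R) : R := limn (series (absseq (fterm beta u x))).

Lemma series_fterm_le beta u (x y : R) n : 0 < beta -> expbounded u -> `|x| <= y ->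
  series (absseq (fterm beta u x)) n <= fmajor beta u y.
Proof.
move=> b0 eu xy; have cy := @cvg_fterm_norm _ _ y b0 eu.
apply: (@le_trans _ _ (series (absseq (fterm beta u y)) n)).
  apply: ler_sum_nat => k _; rewrite /absseq /fterm !normrM ler_wpM2l// !normrX.
  by apply: lerXn2r; rewrite ?nnegrE// (le_trans xy)// ler_norm.
apply: nondecreasing_cvgn_le => //; apply: nd_series => k; by rewrite /absseq.
Qed.

Lemma fmajor_le beta u (x y : R) : 0 < beta -> expbounded u -> `|x| <= y ->
  fmajor beta u x <= fmajor beta u y.
Proof.
move=> b0 eu xy; apply: limr_le; first exact: cvg_fterm_norm.
by apply: nearW => n; exact: series_fterm_le.
Qed.

Lemma fmajor_ge0 beta u (x : R) : 0 < beta -> expbounded u -> 0 <= fmajor beta u x.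
Proof.
move=> b0 eu; apply: limr_ge; first exact: cvg_fterm_norm.
by apply: nearW => n; rewrite /series/= sumr_ge0// => i _; rewrite /absseq.
Qed.

Lemma fracseries_bound beta u (t T : R) : 0 < beta -> expbounded u -> 0 < t -> t <= T ->
  `|fracseries beta u t| <= fmajor beta u (T `^ alpha) * t `^ (beta - 1).
Proof.
move=> b0 eu t0 tT; rewrite /fracseries normrM ger0_norm ?powR_ge0// mulrC ler_wpM2r ?powR_ge0//.
apply: (@le_trans _ _ (fmajor beta u (t `^ alpha))).
  by rewrite fsumE; apply: lim_series_norm; exact: cvg_fterm_norm.
apply: fmajor_le => //; rewrite ger0_norm ?powR_ge0//.
by apply: ge0_ler_powR; rewrite ?nnegrE ?(ltW alpha0) ?(ltW t0) ?(le_trans (ltW t0) tT).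
Qed.

Lemma powR_fidx beta (t : R) (k : nat) : 0 < t ->
  t `^ (beta - 1) * (t `^ alpha) ^+ k = t `^ (beta + alpha * k%:R - 1).
Proof.
move=> t0; rewrite -powR_mulrn ?powR_ge0// -powRrM -powRD ?(gt_eqF t0) ?implybT//.
by congr (_ `^ _); ring.
Qed.

(** The Cauchy partial sums of the product are finite combinations of
[(t - s)^(x-1) s^(y-1)], integrated by the Beta identity.  They are dominated by
a multiple of [(t - s)^(beta-1) s^(gamma-1)], so the limit can be taken under
the integral. *)
Lemma fracseries_convolution beta gamma u v (t : R) : 0 < beta -> 0 < gamma ->
  expbounded u -> expbounded v -> 0 < t ->
  mu.-integrable `]0, t[
    (fun s => (fracseries beta u (t - s) * fracseries gamma v s)%:E) /\
  (\int[mu]_(s in `]0%R, t[) (fracseries beta u (t - s) * fracseries gamma v s)%:E =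
   (fracseries (beta + gamma) (seqconv u v) t)%:E)%E.
Proof.
move=> b0 g0 eu ev t0.
have bg0 : 0 < beta + gamma by rewrite addr_gt0.
have euv := expbounded_conv eu ev.
pose D : set R := `]0, t[%classic.
have mD : measurable D by exact: measurable_itv.
pose p l m (s : R) := (t - s) `^ (beta + alpha * l%:R - 1) * s `^ (gamma + alpha * m%:R - 1).
pose F n (s : R) := \sum_(0 <= k < n) \sum_(0 <= l < k.+1)
  fcoef beta u l * fcoef gamma v (k - l)%N * p l (k - l)%N s.
have FE n s : D s -> F n s = (t - s) `^ (beta - 1) * s `^ (gamma - 1) *
    series (seqconv (fterm beta u ((t - s) `^ alpha)) (fterm gamma v (s `^ alpha))) n.
  rewrite /D /= in_itv/= => /andP[s0 st]; rewrite /F mulr_sumr.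
  apply: eq_bigr => k _; rewrite /seqconv mulr_sumr; apply: eq_bigr => l _.
  by rewrite /p -!powR_fidx ?subr_gt0// /fterm; ring.
have cF s : D s -> (fun n => (F n s)%:E) @ \oo --> (fracseries beta u (t - s) * fracseries gamma v s)%:E.
  move=> Ds; apply: cvg_EFin; first by apply: nearW.
  rewrite (_ : _ \o _ = fun n => (t - s) `^ (beta - 1) * s `^ (gamma - 1) *
    series (seqconv (fterm beta u ((t - s) `^ alpha)) (fterm gamma v (s `^ alpha))) n); last first.
    by apply/funext => n /=; exact: FE.
  rewrite (_ : fracseries _ _ _ * _ = (t - s) `^ (beta - 1) * s `^ (gamma - 1) *
    (fsum beta u ((t - s) `^ alpha) * fsum gamma v (s `^ alpha))); last by rewrite /fracseries; ring.
  apply: cvgM; first exact: cvg_cst.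
  by rewrite !fsumE; apply: cvg_cauchy_product; exact: cvg_fterm_norm.
pose M := fmajor beta u (t `^ alpha) * fmajor gamma v (t `^ alpha).
have pb s : 0 < s -> s < t -> `|s `^ alpha| <= t `^ alpha.
  move=> s0 st; rewrite ger0_norm ?powR_ge0//.
  by apply: ge0_ler_powR; rewrite ?nnegrE ltW.
have F_le n s : D s -> `|F n s| <= M * ((t - s) `^ (beta - 1) * s `^ (gamma - 1)).
  move=> Ds; rewrite FE// normrM ger0_norm ?mulr_ge0 ?powR_ge0// mulrC.
  rewrite ler_wpM2r ?mulr_ge0 ?powR_ge0//.
  move: Ds; rewrite /D /= in_itv/= => /andP[s0 st].
  apply: (le_trans (norm_series_seqconv_le _ _ _)); [exact: cvg_fterm_norm|exact: cvg_fterm_norm|].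
  apply: ler_pM; [exact: fmajor_ge0|exact: fmajor_ge0| |].
  - by apply: fmajor_le => //; apply: pb; rewrite ?subr_gt0// gtrBl.
  - by apply: fmajor_le => //; exact: pb.
have mp l m : measurable_fun D (p l m) by exact: measurable_powR_conv.
have ip c l m : mu.-integrable D (fun s : R => (c * p l m s)%:E).
  by apply: integrable_powR_convZ => //; exact: fidx_gt0.
have mF n : measurable_fun D (F n).
  apply: measurable_sum => k; apply: measurable_sum => l.
  by apply: measurable_funM => //; exact: measurable_cst.
have [|||||iF _ cI] := @dominated_convergence _ _ R mu D mD (fun n s => (F n s)%:E)
  (fun s => (fracseries beta u (t - s) * fracseries gamma v s)%:E)
  (fun s => (M * ((t - s) `^ (beta - 1) * s `^ (gamma - 1)))%:E).
- by move=> n; apply/measurable_EFinP; exact: mF.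
- apply/measurable_EFinP; apply: measurable_funTS; apply: measurable_funM.
    apply: (@measurable_translate_rev _ t (fracseries beta u)).
    exact: measurable_fracseries.
  exact: measurable_fracseries.
- by apply: aeW => s Ds; exact: cF.
- exact: integrable_powR_convZ.
- by apply: (aeW mu) => s n Ds; rewrite lee_fin; exact: F_le.
split; first exact: iF.
have IF n : (\int[mu]_(s in D) (F n s)%:E = (t `^ (beta + gamma - 1) *
    series (fterm (beta + gamma) (seqconv u v) (t `^ alpha)) n)%:E)%E.
  rewrite /F; under eq_integral do rewrite -sumEFin.
  rewrite integral_sum//; last first.
    move=> k; under eq_fun do rewrite -sumEFin.
    by apply: integrable_sum => // l _; exact: ip.
  rewrite /series/= mulr_sumr -sumEFin; apply: eq_bigr => k _.
  under eq_integral do rewrite -sumEFin.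
  rewrite integral_sum//.
  rewrite /fterm /fcoef /seqconv !mulr_suml mulr_sumr -sumEFin.
  apply: eq_big_nat => l /andP[_ lk].
  under eq_integral do rewrite EFinM.
  rewrite integralZl//; last by apply: integrable_powR_conv => //; exact: fidx_gt0.
  rewrite integral_powR_conv ?fidx_gt0// -EFinM; congr (_%:E).
  have G1 := Gamma_gt0 (fidx_gt0 l b0); have G2 := Gamma_gt0 (fidx_gt0 (k - l) g0).
  have E : beta + alpha * l%:R + (gamma + alpha * (k - l)%:R) = beta + gamma + alpha * k%:R.
    by rewrite natrB//; ring.
  rewrite E -powR_fidx//; have G3 := Gamma_gt0 (fidx_gt0 k bg0).
  move: G1 G2 G3; move: (Gamma (beta + _)) (Gamma (gamma + _)) (Gamma (beta + gamma + _)).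
  by move=> g1 g2 g3 G1 G2 G3; field; rewrite !gt_eqF.
have c2 : (fun n => (t `^ (beta + gamma - 1) *
    series (fterm (beta + gamma) (seqconv u v) (t `^ alpha)) n)%:E) @ \oo -->
    (fracseries (beta + gamma) (seqconv u v) t)%:E.
  apply: cvg_EFin; first by apply: nearW.
  apply: cvgM; first exact: cvg_cst.
  by rewrite fsumE; exact: cvg_pseries_fcoef.
have := cI; rewrite (_ : [sequence _]_n = (fun n => (t `^ (beta + gamma - 1) *
    series (fterm (beta + gamma) (seqconv u v) (t `^ alpha)) n)%:E)); last first.
  by apply/funext => n; rewrite -IF.
by move=> cI'; apply: (cvg_unique _ cI' c2).
Qed.

End FractionalSeries.

(** * Uniqueness by means of a complementary kernel *)

Section Uniqueness.
Context {R : realType}.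
Local Notation mu := (@lebesgue_measure R).

Lemma measurable_pospart (f : R -> R) : measurable_fun setT f ->
  measurable_fun setT (pospart f).
Proof.
by move=> mf; apply/(measurable_restrictT _ _).1 => //; exact: measurable_funTS.
Qed.

Lemma pospart_itv (f g : R -> R) (t s : R) :
  pospart f (t - s) * pospart g s = ((fun s => f (t - s) * g s) \_ `]0, t[) s.
Proof.
rewrite patchE; case: ifPn => [/set_mem|/negP].
  by rewrite /= in_itv/= => /andP[s0 st]; rewrite !pospartE ?subr_gt0.
have [s0|s0] := leP s 0; first by rewrite [pospart g s]pospart0 ?mulr0.
have [st|st] := leP t s; first by rewrite [pospart f _]pospart0 ?mul0r// subr_le0.
by case; rewrite inE/= in_itv/= s0.
Qed.

Lemma integral_pospart_conv (f g : R -> R) (t : R) :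
  (\int[mu]_s (pospart f (t - s) * pospart g s)%:E =
   \int[mu]_(s in `]0%R, t[) (f (t - s) * g s)%:E)%E.
Proof.
rewrite [RHS]integral_mkcond; apply: eq_integral => s _.
by rewrite pospart_itv !patchE; case: ifPn.
Qed.

(** [g] is the kernel of the equation and [h] a complementary kernel, with
[h] convolved with [g] equal to [1].  Their singularities at [0] are those of
[t^(p-1)] and [t^(q-1)] with [p + q = 1], so that the convolution of the
majorants is constant. *)
Section Kernels.
Variables (g h psi : R -> R) (p q : R).
Hypotheses (p0 : 0 < p) (q0 : 0 < q) (pq : p + q = 1).
Hypotheses (mg : measurable_fun setT g) (mh : measurable_fun setT h).
Hypothesis gb : forall T, 0 < T ->
  exists M, forall t, 0 < t -> t <= T -> `|g t| <= M * t `^ (p - 1).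
Hypothesis hb : forall T, 0 < T ->
  exists M, forall t, 0 < t -> t <= T -> `|h t| <= M * t `^ (q - 1).
Hypothesis hg : forall t, 0 < t ->
  mu.-integrable `]0, t[ (fun s => (h (t - s) * g s)%:E) /\
  (\int[mu]_(s in `]0%R, t[) (h (t - s) * g s)%:E = 1)%E.
Hypothesis ipsi : forall T, 0 < T -> mu.-integrable `[0, T] (EFin \o psi).
Hypothesis gpsi : forall t, 0 < t ->
  mu.-integrable `]0, t[ (fun s => (g (t - s) * psi s)%:E) /\
  (\int[mu]_(s in `]0%R, t[) (g (t - s) * psi s)%:E = 0)%E.

Let P (T : R) : R -> R := psi \_ `]0, T[.

(* The integrand of [h] convolved with [g] convolved with [psi] at time [T]; the
   extensions by zero restrict it to [0 < s < t < T], where [z = (t, s)]. *)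
Let F (T : R) (z : R * R) : \bar R :=
  (pospart h (T - z.1) * pospart g (z.1 - z.2) * P T z.2)%:E.

Let integrable_P T : 0 < T -> mu.-integrable setT (EFin \o P T).
Proof.
move=> T0; rewrite /P -restrict_EFin; apply/(integrable_mkcond _ _).1 => //.
apply: integrableS (ipsi T0) => //.
by apply: subset_itv; rewrite bnd_simp.
Qed.

Let measurable_P T : 0 < T -> measurable_fun setT (P T).
Proof. by move=> T0; have /measurable_int/measurable_EFinP := integrable_P T0. Qed.

Let measurable_F T : 0 < T -> measurable_fun setT (F T).
Proof.
move=> T0; apply/measurable_EFinP; apply: measurable_funM.
  apply: measurable_funM.
    apply: (measurableT_comp (measurable_pospart mh)).
    by apply: measurable_funB; [exact: measurable_cst|exact: measurable_fst].
  apply: (measurableT_comp (measurable_pospart mg)).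
  by apply: measurable_funB; [exact: measurable_fst|exact: measurable_snd].
by apply: (measurableT_comp (measurable_P T0)); exact: measurable_snd.
Qed.

Let kernel_bound T : 0 < T -> exists2 M : R, 0 <= M & forall s t, 0 < s ->
  `|pospart h (T - s - t) * pospart g t| <= M * (kpow q (T - s - t) * kpow p t).
Proof.
move=> T0; have [M hM] := hb T0; have [N gN] := gb T0.
exists (`|M| * `|N|); first by rewrite mulr_ge0.
move=> s t s0.
have [t0|t0] := leP t 0.
  by rewrite [pospart g t]pospart0// mulr0 normr0 !mulr_ge0 ?kpow_ge0.
have [st|st] := leP (T - s - t) 0.
  by rewrite [pospart h _]pospart0// mul0r normr0 !mulr_ge0 ?kpow_ge0.
rewrite /kpow !pospartE// normrM.
rewrite (_ : `|M| * `|N| * _ = `|M| * (T - s - t) `^ (q - 1) * (`|N| * t `^ (p - 1))); last ring.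
apply: ler_pM => //.
  apply: (le_trans (hM _ st _)); first by rewrite -addrA gerDl -opprD oppr_le0 ltW// addr_gt0.
  by rewrite ler_wpM2r ?powR_ge0// ler_norm.
apply: (le_trans (gN _ t0 _)); last by rewrite ler_wpM2r ?powR_ge0// ler_norm.
by rewrite -subr_ge0 (le_trans (ltW st))// lerD2r gerBl ltW.
Qed.

Let measurable_hg c : measurable_fun setT (fun t : R => pospart h (c - t) * pospart g t).
Proof.
apply: measurable_funM; last exact: measurable_pospart.
by apply: (@measurable_translate_rev _ c (pospart h)); exact: measurable_pospart.
Qed.

Let shift_abs_hg T s : (\int[mu]_t `|(pospart h (T - t) * pospart g (t - s))%:E| =
  \int[mu]_t `|(pospart h (T - s - t) * pospart g t)%:E|)%E.
Proof.
have m : measurable_fun setT (fun t : R => `|(pospart h (T - s - t) * pospart g t)%:E|%E).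
  apply: measurableT_comp => //.
  by apply/measurable_EFinP; exact: measurable_hg.
rewrite -(integral_translation (- s) m); apply: eq_integral => t _.
by congr (`|(pospart h _ * _)%:E|%E); ring.
Qed.

Let integrable_F T : 0 < T -> (mu \x mu)%E.-integrable setT (F T).
Proof.
move=> T0; apply/integrable21ltyP; first exact: measurable_F.
have [M M0 hM] := kernel_bound T0.
pose C : R := M * (Gamma q * Gamma p / Gamma 1).
have C0 : 0 <= C.
  by rewrite /C mulr_ge0// divr_ge0 ?mulr_ge0 ?ltW// Gamma_gt0.
have iP := integrable_P T0.
have mP := measurable_P T0.
have step (s : R) : (\int[mu]_t `|F T (t, s)| <= C%:E * `|(P T s)%:E|)%E.
  have [s0|s0] := leP s 0.
    rewrite integral0_eq ?mule_ge0 ?lee_fin// => t _.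
    rewrite /F /P patchE memNset ?mulr0 ?abse0//= in_itv/= => /andP[+ _].
    by rewrite ltNge s0.
  have -> : (\int[mu]_t `|F T (t, s)| =
      `|(P T s)%:E| * \int[mu]_t `|(pospart h (T - t) * pospart g (t - s))%:E|)%E.
    rewrite -ge0_integralZl//.
    - by apply: eq_integral => t _; rewrite /F EFinM abseM muleC.
    - apply: measurableT_comp => //; apply/measurable_EFinP.
      apply: measurable_funM.
        by apply: (@measurable_translate_rev _ T (pospart h)); exact: measurable_pospart.
      apply: (measurableT_comp (measurable_pospart mg)).
      by apply: measurable_funB => //; exact: measurable_cst.
  rewrite muleC shift_abs_hg; apply: lee_wpmul2r => //.
  apply: (@le_trans _ _ (\int[mu]_t (M%:E * (kpow q (T - s - t) * kpow p t)%:E))%E).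
    apply: ge0_le_integral => //.
    - apply: measurableT_comp => //.
      by apply/measurable_EFinP; exact: measurable_hg.
    - apply: measurable_funeM; apply/measurable_EFinP; apply: measurable_funM.
        by apply: (@measurable_translate_rev _ (T - s) (kpow q)); exact: measurable_kpow.
      exact: measurable_kpow.
    - by move=> t _; rewrite -EFinM lee_fin; exact: hM.
  rewrite ge0_integralZl//; last 2 first.
  - apply/measurable_EFinP; apply: measurable_funM.
      by apply: (@measurable_translate_rev _ (T - s) (kpow q)); exact: measurable_kpow.
    exact: measurable_kpow.
  - by move=> t _; rewrite lee_fin !mulr_ge0 ?kpow_ge0.
  rewrite -/(kconv q p (T - s)) kconv_Gamma// addrC pq -EFinM lee_fin; apply: ler_wpM2l => //.
  have D0 : 0 <= Gamma q * Gamma p / Gamma 1.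
    by rewrite divr_ge0 ?mulr_ge0 ?ltW// Gamma_gt0.
  rewrite ler_piMr//; have [ts|ts] := leP (T - s) 0; first by rewrite /kpow pospart0.
  by rewrite /kpow pospartE// subrr powRr0.
apply: (@le_lt_trans _ _ (\int[mu]_s (C%:E * `|(P T s)%:E|))%E).
  apply: ge0_le_integral => //.
  - by move=> s _; apply: integral_ge0.
  - apply: (measurable_fun_fubini_tonelli_G (m1 := mu) (fun z => `|F T z|)%E) => //.
    by apply: measurableT_comp => //; exact: measurable_F.
  - by apply: measurable_funeM; apply: measurableT_comp => //; exact/measurable_EFinP.
rewrite ge0_integralZl//; last first.
- by apply: measurableT_comp => //; exact/measurable_EFinP.
have /integrableP[_ ] := iP.
by move=> h1; apply: lte_mul_pinfty => //; rewrite lee_fin.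
Qed.

(** Fubini's theorem for [h (T - t) * g (t - s) * psi s] on [0 < s < t < T]:
integrating in [s] first gives [0] by the equation satisfied by [psi], and
integrating in [t] first leaves [psi s], because [h] convolved with [g] is [1]. *)
Lemma primitive_eq0 T : 0 < T -> (\int[mu]_(s in `]0%R, T[) (psi s)%:E = 0)%E.
Proof.
move=> T0; have := Fubini (integrable_F T0).
rewrite integral0_eq; last first.
  move=> t _.
  have [tT|tT] := leP T t.
    apply: integral0_eq => s _.
    by rewrite /F/= [pospart h _]pospart0 ?subr_le0// !mul0r.
  have [t0|t0] := leP t 0.
    apply: integral0_eq => s _; rewrite /F/=.
    have [s0|s0] := leP s 0.
      rewrite /P patchE memNset ?mulr0//= in_itv/= => /andP[+ _].
      by rewrite ltNge s0.
    by rewrite [pospart g _]pospart0 ?mulr0 ?mul0r// subr_le0 (le_trans t0)// ltW.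
  have [ig Ig] := gpsi t0.
  have -> : (\int[mu]_s F T (t, s) =
     \int[mu]_(s in `]0%R, t[) ((pospart h (T - t))%:E * (g (t - s) * psi s)%:E))%E.
    rewrite [RHS]integral_mkcond; apply: eq_integral => s _; rewrite patchE /F/=.
    case: ifPn => [/set_mem|/negP].
      rewrite /= in_itv/= => /andP[s0 st]; rewrite -EFinM -mulrA; congr (_ * _)%:E.
      rewrite /P patchE mem_set ?[pospart g _]pospartE ?subr_gt0//=.
      by rewrite in_itv/= s0 (lt_trans st).
    have [s0|s0] := leP s 0.
      move=> _; rewrite /P patchE memNset ?mulr0//= in_itv/= => /andP[+ _].
      by rewrite ltNge s0.
    have [st|st] := leP t s; first by rewrite [pospart g _]pospart0 ?mulr0 ?mul0r// subr_le0.
    by case; rewrite inE/= in_itv/= s0.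
  by rewrite integralZl// Ig mule0.
move=> /esym E; rewrite -E [LHS]integral_mkcond; apply: eq_integral => s _.
rewrite patchE; case: ifPn => [/set_mem|sT]; last first.
  apply/esym/integral0_eq => t _.
  by rewrite /F /P/= patchE (negbTE sT) mulr0.
rewrite /= in_itv/= => /andP[s0 sT].
have Ts : 0 < T - s by rewrite subr_gt0.
have [ih Ih] := hg Ts.
have PE : P T s = psi s by rewrite /P patchE mem_set//= in_itv/= s0.
have m : measurable_fun setT (fun t : R => (pospart h (T - s - t) * pospart g t)%:E).
  by apply/measurable_EFinP; exact: measurable_hg.
have i : mu.-integrable setT (fun t : R => (pospart h (T - s - t) * pospart g t)%:E).
  have := (integrable_mkcond (mu := mu) _ (measurable_itv `]0, T - s[)).1 ih.
  apply: eq_integrable => // t _.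
  by rewrite pospart_itv !patchE; case: ifPn.
have E1 : (\int[mu]_t (pospart h (T - s - t) * pospart g t)%:E = 1)%E.
  by rewrite integral_pospart_conv.
transitivity (\int[mu]_t ((pospart h (T - s - t) * pospart g t)%:E * (psi s)%:E))%E.
  by rewrite integralZr// E1 mul1e.
have m2 : measurable_fun setT
    (fun t : R => (pospart h (T - s - t) * pospart g t)%:E * (psi s)%:E)%E.
  by under eq_fun do rewrite muleC; exact: measurable_funeM.
rewrite -(integral_translation (- s) m2); apply: eq_integral => t _.
rewrite /F/= PE -EFinM; congr (pospart h _ * _ * _)%:E; ring.
Qed.

End Kernels.

(** Lebesgue's differentiation theorem for [psi] truncated to [[0, n + 1]], then a
countable intersection over [n].  The primitive is taken from [-1] so that
the point [0] is covered too. *)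
Lemma ae_eq0_of_primitive (psi : R -> R) :
  (forall T, 0 < T -> mu.-integrable `[0, T] (EFin \o psi)) ->
  (forall T, 0 < T -> (\int[mu]_(s in `]0%R, T[) (psi s)%:E = 0)%E) ->
  {ae mu, forall t, 0 <= t -> psi t = 0}.
Proof.
move=> ipsi I0.
pose f (n : nat) : R -> R := psi \_ `[0, n.+1%:R].
have iD (n : nat) : mu.-integrable setT (EFin \o f n).
  rewrite /f -restrict_EFin.
  have := (integrable_mkcond (mu := mu) (EFin \o psi) (measurable_itv `[0, n.+1%:R])).1.
  by apply; apply: ipsi.
have Rint0 T : (\int[mu]_(s in `[0%R, T]) psi s = 0)%R.
  have [T0|T0] := leP T 0.
    have [->|Tn0] := eqVneq T 0; first by rewrite set_itv1 Rintegral_set1.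
    by rewrite set_itv_ge ?Rintegral_set0// bnd_simp -ltNge lt_neqAle Tn0.
  have iT := ipsi _ T0.
  have i1 : mu.-integrable `[0, T[ (EFin \o psi).
    by apply: integrableS iT => //; apply: subset_itv; rewrite bnd_simp.
  have i2 : mu.-integrable `]0, T[ (EFin \o psi).
    by apply: integrableS iT => //; apply: subset_itv; rewrite bnd_simp.
  rewrite -Rintegral_itv_bndo_bndc// -Rintegral_itv_obnd_cbnd//.
  by rewrite /Rintegral (I0 _ T0).
have F0 n (x : R) : (\int[mu]_(s in `[(- 1)%R, x]) f n s = 0)%R.
  rewrite /f -Rintegral_mkcondr.
  rewrite (_ : _ `&` _ = `[0, Num.min x n.+1%:R]%classic) ?Rint0//.
  apply/seteqP; split => s /=; rewrite !in_itv/= le_min.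
    by move=> [/andP[_ ->] /andP[-> ->]].
  move=> /andP[s0 /andP[-> ->]]; rewrite s0; split=> //.
  by rewrite (le_trans _ s0)// lerN10.
have aen n : {ae mu, forall t : R, 0 <= t -> f n t = 0}.
  have h1 y : mu.-integrable [set` Interval (BLeft (- 1 : R)) (BRight y)] (EFin \o f n).
    exact: integrableS (iD n).
  have h2 : locally_integrable [set: R] (f n).
    by apply: integrable_locally => //; exact: ipsi.
  have := FTC1 h1 h2; apply: filterS; first exact: (ae_filter_ringOfSetsType mu).
  move=> t ht t0.
  have [|_ <-] := ht; first by rewrite /= lte_fin (lt_le_trans _ t0)// ltrN10.
  rewrite (_ : (fun x => _) = cst 0) ?derive1_cst//.
  by apply/funext => x; exact: F0.
have : {ae mu, forall t : R, forall n, 0 <= t -> f n t = 0} by exact: ae_foralln.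
apply: filterS; first exact: (ae_filter_ringOfSetsType mu).
move=> t ht t0; have := ht (Num.truncn t) t0; rewrite /f patchE mem_set//= in_itv/= t0/= ltW//.
exact: truncnS_gt.
Qed.

(** If the continuous difference were nonzero at [t], it would be nonzero on an
interval with left end [t], which has positive measure. *)
Lemma ae_eq_continuous (f g : R -> R) :
  {within `[0, +oo[, continuous f} -> {within `[0, +oo[, continuous g} ->
  {ae mu, forall t, 0 <= t -> f t = g t} -> forall t, 0 <= t -> f t = g t.
Proof.
move=> cf cg [N [mN N0 sN]] t t0; apply/eqP; rewrite -subr_eq0; apply/negP => /negP d0.
have tD : (`[0, +oo[%classic : set R) t by rewrite /= in_itv/= t0.
have cd : (fun s => f s - g s) @ within `[0%R, +oo[ (nbhs t) --> f t - g t.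
  apply: cvgB; [move: cf|move: cg] => /subspace_continuousP; exact.
move/cvgrPdist_lt : cd => /(_ `|f t - g t|); rewrite normr_gt0 => /(_ d0).
move=> /nbhs_ballP[e /= e0 he].
have sub : `]t, t + e[%classic `<=` N.
  move=> s /=; rewrite in_itv/= => /andP[ts se]; apply: sN => /=.
  have s0 : 0 <= s by rewrite (le_trans t0)// ltW.
  move=> /(_ s0) fg; have := he s.
  rewrite /ball/= ltr0_norm ?subr_lt0// opprB ltrBlDl se => /(_ isT).
  by rewrite in_itv/= s0 => /(_ isT); rewrite fg subrr subr0 ltxx.
have : (mu `]t, (t + e)%R[ <= 0)%E.
  by rewrite -N0; exact: (le_measure mu (mem_set (measurable_itv `]t, t + e[)) (mem_set mN) sub).
rewrite lebesgue_measure_itv/= lte_fin ltrDl e0 -EFinB lee_fin leNgt.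
by rewrite addrAC subrr add0r e0.
Qed.

End Uniqueness.

(** * Further properties of fractional power series *)

Section SeriesMore.
Context {R : realType} (alpha : R).
Hypothesis alpha0 : 0 < alpha.
Local Notation mu := (@lebesgue_measure R).
Local Notation fsum := (@fsum R alpha).
Local Notation fracseries := (@fracseries R alpha).
Implicit Types (u v : R^nat) (beta gamma : R).

Lemma fsumZ beta u (c x : R) : 0 < beta -> expbounded u ->
  fsum beta (fun k => c * u k) x = c * fsum beta u x.
Proof.
move=> b0 eu.
have cv : cvgn (series (fterm alpha beta u x)) by exact: cvg_pseries_fcoef.
rewrite !fsumE -[RHS](lim_seriesZ c cv); congr (limn (series _)); apply/funext => k.
by rewrite /fterm /fcoef fctE /GRing.scale/= !mulrA.
Qed.

Lemma seqconvC u v : seqconv u v = seqconv v u.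
Proof.
apply/funext => k; rewrite /seqconv big_nat_rev /=; apply: eq_big_nat => l /andP[_ lk].
by rewrite add0n subSS subKn// mulrC.
Qed.

Lemma fracseries1_delta (t : R) : 0 < t -> fracseries 1 (fun k => (k == 0%N)%:R) t = 1.
Proof.
move=> t0; rewrite /fracseries subrr powRr0 mul1r fsumE; apply/cvg_lim => //.
apply: cvg_near_cst; near=> n.
have -> : n = n.-1.+1 by rewrite prednK//; near: n; exact: nbhs_infty_gt.
rewrite /series/= big_nat_recl// big1_seq; last first.
  by move=> i _; rewrite /fterm /fcoef/= !mul0r.
by rewrite addr0 /fterm /fcoef expr0 mulr1 eqxx !mulr0 addr0 Gamma1 divr1.
Unshelve. all: end_near. Qed.

(** At [0] continuity holds because [beta > 1] makes [t^(beta-1)] tend to [0]. *)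
Lemma fracseries_continuous beta u : 1 < beta -> expbounded u ->
  {within `[0, +oo[, continuous (fracseries beta u)}.
Proof.
move=> b1 eu; have b0 : 0 < beta by rewrite (lt_trans ltr01).
have cS := continuous_fsum alpha0 b0 eu.
have cSp (t : R) : 0 < t -> {for t, continuous (fsum beta u \o (fun x => x `^ alpha))}.
  by move=> t0; apply: continuous_comp; [exact: continuous_powR|exact: cS].
apply/continuous_within_itvcyP; split.
  move=> t; rewrite in_itv/= andbT => t0.
  by apply: cvgM; [exact: continuous_powR|exact: cSp].
rewrite /fracseries.
have p0 : (0 : R) `^ alpha = 0 by rewrite powR0// gt_eqF.
have p1 : (0 : R) `^ (beta - 1) = 0 by rewrite powR0// subr_eq0 gt_eqF.
apply: cvgM.
  by rewrite p1; apply: powR_cvg0; rewrite subr_gt0.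
apply: (@cvg_comp _ _ _ (fun x => x `^ alpha) (fsum beta u) _ (nbhs (0 `^ alpha))).
  by rewrite p0; exact: powR_cvg0.
exact: cS.
Qed.

Definition invGamma_seq (x : R) : R^nat := fun k => (Gamma (x + alpha * k%:R))^-1.

(** By [invGammaM_le] each of the [k + 1] terms of the convolution is at most a
geometric factor over [Gamma (x + y + alpha k)], and the Gamma factor in front
cancels this up to [x + y - 1 + alpha k]. *)
Lemma expbounded_invGamma_conv (x y : R) : 0 < x -> 0 < y -> 0 < x + y - 1 ->
  expbounded (fun k => Gamma (x + y - 1 + alpha * k%:R) *
    seqconv (invGamma_seq x) (invGamma_seq y) k).
Proof.
move=> x0 y0 xy1.
exists (2 * 4 `^ (x + y) / (x + y - 1)), (2 * 4 `^ alpha) => k.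
have G0 := Gamma_gt0 (fidx_gt0 alpha0 k xy1).
have xyk := fidx_gt0 alpha0 k xy1.
have i0 (z : R) (l : nat) : 0 < z -> 0 < invGamma_seq z l.
  by move=> z0; rewrite invr_gt0; apply: Gamma_gt0; exact: fidx_gt0.
have s0 : 0 <= seqconv (invGamma_seq x) (invGamma_seq y) k.
  by rewrite sumr_ge0// => l _; rewrite mulr_ge0 ?ltW// i0.
rewrite ger0_norm; last by rewrite mulr_ge0// ltW.
have E : x + y + alpha * k%:R = x + y - 1 + alpha * k%:R + 1 by ring.
have p4 : 0 < (4 : R) `^ (x + y + alpha * k%:R) by rewrite powR_gt0.
have h : seqconv (invGamma_seq x) (invGamma_seq y) k <=
    k.+1%:R * (2 * 4 `^ (x + y + alpha * k%:R) / Gamma (x + y + alpha * k%:R)).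
  rewrite /seqconv mulr_natl -[X in _ *+ X]subn0 -sumr_const_nat.
  apply: ler_sum_nat => l /andP[_ lk]; rewrite /invGamma_seq -invfM.
  rewrite (_ : x + y + alpha * k%:R = x + alpha * l%:R + (y + alpha * (k - l)%:R)).
    by apply: invGammaM_le; exact: fidx_gt0.
  by rewrite natrB//; ring.
apply: (@le_trans _ _ (Gamma (x + y - 1 + alpha * k%:R) *
    (2 ^+ k * (2 * 4 `^ (x + y + alpha * k%:R) / Gamma (x + y + alpha * k%:R))))).
  rewrite ler_pM2l//; apply: (le_trans h); rewrite ler_wpM2r//.
    apply: divr_ge0; first by rewrite mulr_ge0// (ltW p4).
    by apply/ltW/Gamma_gt0; rewrite E; apply: addr_gt0.
  by rewrite -natrX ler_nat ltn_expl.
rewrite E (GammaS xyk) -E powRD ?pnatr_eq0 ?implybT// powRrM powR_mulrn ?powR_ge0//.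
move: G0 xyk p4; set g := Gamma _; set z := x + y - 1 + _.
move=> G0 z0 _; rewrite exprMn.
rewrite (_ : g * _ = 2 * 4 `^ (x + y) * (2 ^+ k * 4 `^ alpha ^+ k) / z); last first.
  by field; rewrite !gt_eqF.
rewrite -!mulrA ler_pM2l// ler_pM2l ?powR_gt0// [leRHS]mulrC -!mulrA.
rewrite ler_pM2l ?exprn_gt0// ler_pM2l ?exprn_gt0 ?powR_gt0//.
by rewrite lef_pV2 ?posrE// lerDl mulr_ge0// ltW.
Qed.

End SeriesMore.

(** * The coefficients of the expansion *)

Section Main.
Context {R : realType} (alpha : R) (ck : R^nat).
Hypothesis halpha : 1 / 2 < alpha < 1.
Hypothesis hck : c_recursion alpha ck.
Local Notation mu := (@lebesgue_measure R).
Local Notation fsum := (@fsum R alpha).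
Local Notation fracseries := (@fracseries R alpha).

Let alpha0 : 0 < alpha.
Proof. by case/andP: halpha => h _; lra. Qed.

Let alpha1 : 0 < 2 - alpha.
Proof. by case/andP: halpha => _ h; lra. Qed.

Let alpha2 : 0 < 2 * alpha - 1.
Proof. by case/andP: halpha => h _; lra. Qed.

Let alphaS (k : nat) : alpha * k.+1%:R = alpha + alpha * k%:R.
Proof. by rewrite -natr1; ring. Qed.

Lemma seqaE : seqa alpha = invGamma_seq alpha 1.
Proof. by apply/funext => k; rewrite /seqa /invGamma_seq addrC. Qed.

Lemma seqbE : seqb alpha = invGamma_seq alpha alpha.
Proof. by apply/funext => k; rewrite /seqb /invGamma_seq alphaS. Qed.

(** The coefficients of the squared density, of the left-hand side of the equation,
and of the expansion, each without its power of [- lambda] and multiplied by the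
Gamma factor of the corresponding fractional power series. *)
Definition f2_coef : R^nat := fun k =>
  Gamma (2 * alpha - 1 + alpha * k%:R) * seqconv (seqb alpha) (seqb alpha) k.

Definition lhs_coef : R^nat := fun k =>
  Gamma (alpha + alpha * k%:R) * seqconv (seqa alpha) (seqb alpha) k.

Definition expansion_coef : R^nat := fun k => Gamma (2 - alpha + alpha * k%:R) * ck k.

Lemma expbounded_f2_coef : expbounded f2_coef.
Proof.
have aa : 0 < alpha + alpha - 1 by rewrite -mulr2n -mulr_natl.
have := expbounded_invGamma_conv alpha0 alpha0 alpha0 aa.
by rewrite -seqbE (_ : alpha + alpha = 2 * alpha)//; ring.
Qed.

Lemma expbounded_lhs_coef : expbounded lhs_coef.
Proof.
have aa : 0 < 1 + alpha - 1 by rewrite addrAC subrr add0r.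
have := expbounded_invGamma_conv alpha0 ltr01 alpha0 aa.
by rewrite -seqbE -seqaE addrAC subrr add0r.
Qed.

Lemma f2_coef0 : f2_coef 0 = Gamma (2 * alpha - 1) / Gamma alpha ^+ 2.
Proof.
by rewrite /f2_coef /seqconv big_nat1 /seqb mulr1 mulr0 addr0 -invfM expr2.
Qed.

Lemma f2_coef0_gt0 : 0 < f2_coef 0.
Proof. by rewrite f2_coef0 divr_gt0 ?exprn_gt0 ?Gamma_gt0. Qed.

(** This is the recursion for [c_k]: isolating the term [l = 0] of the convolution
and solving for [ck k] gives [c_step]. *)
Lemma f2_coef_expansion_coef : seqconv f2_coef expansion_coef = lhs_coef.
Proof.
have [c0 cS] := hck.
have Ga := Gamma_gt0 alpha0; have G1 := Gamma_gt0 alpha1; have G2 := Gamma_gt0 alpha2.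
apply/funext => -[|k]; last first.
  rewrite seqconv_recl f2_coef0 {1}/expansion_coef (cS k.+1)// /c_step.
  have -> : \sum_(1 <= l < k.+2) Gamma (alpha * l.+2%:R - 1) *
      Gamma (alpha * (k.+1%:R - l%:R - 1) + 2) *
      seqconv (seqb alpha) (seqb alpha) l * ck (k.+1 - l)%N =
      \sum_(1 <= l < k.+2) f2_coef l * expansion_coef (k.+1 - l)%N.
    apply: eq_big_nat => l /andP[_ lk]; rewrite /f2_coef /expansion_coef natrB//.
    rewrite (_ : alpha * l.+2%:R - 1 = 2 * alpha - 1 + alpha * l%:R); last first.
      by rewrite -addn2 natrD; ring.
    rewrite (_ : alpha * (k.+1%:R - l%:R - 1) + 2 = 2 - alpha + alpha * (k.+1%:R - l%:R)); last ring.
    by ring.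
  rewrite (_ : alpha * (k.+1%:R - 1) + 2 = 2 - alpha + alpha * k.+1%:R); last ring.
  rewrite (alphaS k.+1) -/(lhs_coef k.+1).
  set d := Gamma (2 - alpha + _).
  have d0 : 0 < d by apply: Gamma_gt0; exact: fidx_gt0.
  move: Ga G2; move: (Gamma alpha) (Gamma (2 * alpha - 1)) => a b.
  move=> a0 b0; move: d d0 => d d0.
  move: (lhs_coef k.+1) (\sum_(_ <= _ < _) _) => r S.
  by field; rewrite !gt_eqF.
rewrite /seqconv big_nat1 subn0 f2_coef0 /expansion_coef c0 /lhs_coef /seqconv big_nat1 subn0.
rewrite /seqa /seqb !mulr0 mulr1 !addr0 add0r Gamma1 invr1 mul1r.
move: Ga G1 G2; move: (Gamma alpha) (Gamma (2 - alpha)) (Gamma (2 * alpha - 1)).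
by move=> a b d a0 b0 d0; field; rewrite !gt_eqF.
Qed.

Lemma expbounded_expansion_coef : expbounded expansion_coef.
Proof.
apply: (@expbounded_div _ f2_coef); first by rewrite gt_eqF// f2_coef0_gt0.
  exact: expbounded_f2_coef.
by rewrite f2_coef_expansion_coef; exact: expbounded_lhs_coef.
Qed.

Lemma fcoef_expansion_coef : fcoef alpha (2 - alpha) expansion_coef = ck.
Proof.
apply/funext => k; rewrite /fcoef /expansion_coef mulrAC divff ?mul1r// gt_eqF//.
by apply: Gamma_gt0; exact: fidx_gt0.
Qed.

Lemma cvg_radius_ck : cvg_radius ck = +oo%E.
Proof.
rewrite /cvg_radius; apply/eqyP => M M0.
apply: ereal_sup_ubound; exists M; last by rewrite gtr0_norm.
rewrite /= -fcoef_expansion_coef; apply: cvg_pseries_fcoef => //; exact: expbounded_expansion_coef.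
Qed.

Lemma ck_bound : exists K A : R,
  (Gamma (2 - alpha))^-1 <= K /\ 2 `^ alpha <= A /\
  forall k, `|ck k| <= K * (A ^+ k / Gamma (alpha * k%:R + 2 - alpha)).
Proof.
have [K [A [hK hA _ _ bd]]] :=
  expboundedP (Gamma (2 - alpha))^-1 (2 `^ alpha) expbounded_expansion_coef.
exists K, A; split=> //; split=> // k.
have G0 := Gamma_gt0 (fidx_gt0 alpha0 k alpha1).
rewrite (_ : alpha * k%:R + 2 - alpha = 2 - alpha + alpha * k%:R); last ring.
rewrite mulrA ler_pdivlMr// mulrC; apply: le_trans (bd k).
by rewrite /expansion_coef normrM gtr0_norm.
Qed.

(** * The equation as an identity between fractional power series *)

Section Lambda.
Variables (lambda c : R).

Lemma expbounded_geom (y : R) : expbounded (fun k => y * (- lambda) ^+ k).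
Proof. by exists `|y|, `|lambda| => k; rewrite normrM normrX normrN. Qed.

Lemma powR_fidx0 (t : R) (k : nat) : 0 <= t -> t `^ (alpha * k%:R) = (t `^ alpha) ^+ k.
Proof. by move=> t0; rewrite powRrM powR_mulrn ?powR_ge0. Qed.

(** The factor [1] keeps the coefficients in the shape covered by
[expbounded_geom]. *)
Lemma resolventE (t : R) : 0 <= t ->
  resolvent alpha lambda t = fsum 1 (fun k => 1 * (- lambda) ^+ k) (t `^ alpha).
Proof.
move=> t0; rewrite fsumE /resolvent; congr (limn (series _)); apply/funext => k.
rewrite powR_fidx0// /fterm /fcoef mul1r [alpha * _ + 1]addrC.
by rewrite -[- lambda]mulN1r exprMn; ring.
Qed.

Definition f_seq : R^nat := fun k => lambda * (- lambda) ^+ k.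

(** Termwise differentiation, then [Gamma (x + 1) = x * Gamma x] in each
coefficient. *)
Lemma resolvent_densityE (t : R) : 0 < t ->
  resolvent_density alpha lambda t = fracseries alpha f_seq t.
Proof.
move=> t0; rewrite /resolvent_density.
have e1 := expbounded_geom 1.
have ed := expbounded_diffs e1.
have d1 := is_derive1_powR alpha t0.
have d2 := is_derive_fsum alpha0 (t `^ alpha) ltr01 e1.
rewrite (_ : derive1 _ t =
    derive1 (fsum 1 (fun k => 1 * (- lambda) ^+ k) \o (fun u => u `^ alpha)) t); last first.
  rewrite !derive1E; apply: near_eq_derive => //.
  near=> s; rewrite /= resolventE// ltW//; near: s; exact: lt_nbhsr.
rewrite derive1_comp; [|by case: d1|by case: d2].
rewrite !derive1E; case: d1 => _ ->; case: d2 => _ ->.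
rewrite /fracseries; move: (t `^ alpha) (t `^ (alpha - 1)) => x p.
rewrite (_ : - (_ * _) = p * (- alpha *
    fsum (1 + alpha) (fun k => k.+1%:R * (1 * (- lambda) ^+ k.+1)) x)); last ring.
congr (_ * _); rewrite -(@fsumZ _ _ alpha0 _ _ (- alpha) x (addr_gt0 ltr01 alpha0) ed).
rewrite !fsumE; congr (limn (series _)); apply/funext => k.
rewrite /fterm; congr (_ * _); rewrite /fcoef /f_seq.
have i0 := fidx_gt0 alpha0 k alpha0.
rewrite (_ : 1 + alpha + alpha * k%:R = alpha + alpha * k%:R + 1); last ring.
rewrite (GammaS i0); have := Gamma_gt0 i0; move: (Gamma _) => g g0.
rewrite exprS -natr1 (_ : alpha + alpha * k%:R = alpha * (k%:R + 1)); last ring.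
field; rewrite !gt_eqF//; by rewrite natr1 ltr0n.
Unshelve. all: end_near. Qed.

Definition f2_seq : R^nat := fun k => lambda ^+ 2 * (- lambda) ^+ k * f2_coef k.

Lemma expbounded_f2_seq : expbounded f2_seq.
Proof. by apply: expboundedZ; exact: expbounded_f2_coef. Qed.

Lemma resolvent_density2E (t : R) : 0 < t ->
  resolvent_density alpha lambda t ^+ 2 = fracseries (2 * alpha - 1) f2_seq t.
Proof.
move=> t0; rewrite resolvent_densityE// /fracseries exprMn.
have ed : expbounded f_seq := expbounded_geom lambda.
have cd := @cvg_fterm_norm _ _ alpha0 _ _ (t `^ alpha) alpha0 ed.
rewrite expr2 -powRD ?(gt_eqF t0) ?implybT//.
rewrite (_ : alpha - 1 + (alpha - 1) = 2 * alpha - 1 - 1); last ring.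
congr (_ * _).
rewrite expr2 {1 2}fsumE -(cvg_lim _ (cvg_cauchy_product cd cd))// fsumE.
congr (limn (series _)); apply/funext => k.
transitivity (lambda ^+ 2 * (- lambda) ^+ k * seqconv (seqb alpha) (seqb alpha) k *
    (t `^ alpha) ^+ k); last first.
  rewrite /fterm /fcoef /f2_seq /f2_coef.
  have := Gamma_gt0 (fidx_gt0 alpha0 k alpha2).
  move: (Gamma _) (seqconv _ _ _) => g w g0; field; by rewrite gt_eqF.
rewrite /seqconv mulr_sumr mulr_suml; apply: eq_big_nat => l /andP[_ lk].
have E (y : R) : y ^+ k = y ^+ l * y ^+ (k - l) by rewrite -exprD subnKC.
by rewrite /fterm /fcoef /f_seq /seqb !alphaS !E; ring.
Qed.

Definition expansion_seq : R^nat := fun k => 2 * lambda * c * (- lambda) ^+ k * expansion_coef k.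

Lemma expbounded_expansion_seq : expbounded expansion_seq.
Proof. by apply: expboundedZ; exact: expbounded_expansion_coef. Qed.

Lemma expansionE (t : R) : 0 <= t ->
  varsigma2_expansion alpha lambda c ck t = fracseries (2 - alpha) expansion_seq t.
Proof.
move=> t0; rewrite /varsigma2_expansion /fracseries.
rewrite (_ : 2 - alpha - 1 = 1 - alpha); last ring.
rewrite mulrAC mulrC; congr (_ * _).
have e1 : expbounded (fun k => 1 * (- lambda) ^+ k * expansion_coef k).
  by apply: expboundedZ; exact: expbounded_expansion_coef.
have -> : expansion_seq = fun k => 2 * lambda * c * (1 * (- lambda) ^+ k * expansion_coef k).
  by apply/funext => k; rewrite /expansion_seq mul1r !mulrA.
rewrite (@fsumZ _ _ alpha0 _ _ (2 * lambda * c) _ alpha1 e1) fsumE.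
congr (_ * _); congr (limn (series _)); apply/funext => k.
rewrite powR_fidx0// /fterm -[in LHS]fcoef_expansion_coef /fcoef -[- lambda]mulN1r exprMn.
by ring.
Qed.

(** The coefficient form of [(R^2)' = 2 R R']: write [k + 1 = l + (k + 1 - l)] in
the convolution of [a] with itself and use [alpha (l + 1) a_(l+1) = b_l]; the two
halves are equal by symmetry. *)
Lemma seqconv_seqa_seqa k : 2 * seqconv (seqa alpha) (seqb alpha) k =
  alpha * k.+1%:R * seqconv (seqa alpha) (seqa alpha) k.+1.
Proof.
have ab l : alpha * l.+1%:R * seqa alpha l.+1 = seqb alpha l.
  have l0 : 0 < alpha * l.+1%:R by rewrite mulr_gt0.
  rewrite /seqa /seqb (GammaS l0) invfM mulrA divff ?mul1r//.
  by rewrite gt_eqF.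
have T2 : \sum_(0 <= l < k.+2) seqa alpha l * (alpha * (k.+1 - l)%:R * seqa alpha (k.+1 - l)%N) =
    seqconv (seqa alpha) (seqb alpha) k.
  rewrite big_nat_recr//= subnn mulr0 mul0r mulr0 addr0.
  by apply: eq_big_nat => l /andP[_ lk]; rewrite subSn// ab.
have T1 : \sum_(0 <= l < k.+2) (alpha * l%:R * seqa alpha l) * seqa alpha (k.+1 - l)%N =
    seqconv (seqa alpha) (seqb alpha) k.
  rewrite -T2 big_nat_rev /=; apply: eq_big_nat => l /andP[_ lk].
  by rewrite add0n subSS subKn// mulrC.
rewrite mulr_natl mulr2n -{1}T1 -T2 -big_split /= /seqconv mulr_sumr.
apply: eq_big_nat => l /andP[_ lk].
have -> : k.+1%:R = l%:R + (k.+1 - l)%:R :> R by rewrite -natrD subnKC.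
by ring.
Qed.

Lemma expbounded_geom_lhs_coef : expbounded (fun k => 1 * (- lambda) ^+ k * lhs_coef k).
Proof. by apply: expboundedZ; exact: expbounded_lhs_coef. Qed.

(** The Cauchy square of the resolvent: its term of index [0] is [1], and the others
are given by [seqconv_seqa_seqa]. *)
Lemma one_sub_resolvent2 (t : R) : 0 < t -> 1 - resolvent alpha lambda t ^+ 2 =
  2 * lambda * t `^ alpha *
    fsum (1 + alpha) (fun k => 1 * (- lambda) ^+ k * lhs_coef k) (t `^ alpha).
Proof.
move=> t0; rewrite resolventE ?(ltW t0)//; set x := t `^ alpha.
have e1 := expbounded_geom 1.
have c1 := @cvg_fterm_norm _ _ alpha0 _ _ x ltr01 e1.
have er := expbounded_geom_lhs_coef.
have cr : cvgn (series (fterm alpha (1 + alpha) (fun k => 1 * (- lambda) ^+ k * lhs_coef k) x)).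
  by apply: cvg_pseries_fcoef => //; rewrite addr_gt0.
have cc := cvg_cauchy_product c1 c1.
set w := seqconv _ _ in cc.
have w0 : w 0%N = 1.
  by rewrite /w /seqconv big_nat1 subn0 /fterm /fcoef !mulr0 !addr0 Gamma1 !expr0 invr1 !mulr1.
have wS k : w k.+1 = - (2 * lambda * x) *
    fterm alpha (1 + alpha) (fun k => 1 * (- lambda) ^+ k * lhs_coef k) x k.
  have -> : w k.+1 = (- lambda * x) ^+ k.+1 * seqconv (seqa alpha) (seqa alpha) k.+1.
    rewrite /w /seqconv mulr_sumr; apply: eq_big_nat => l /andP[_ lk].
    have E (y : R) : y ^+ k.+1 = y ^+ l * y ^+ (k.+1 - l) by rewrite -exprD subnKC.
    rewrite /fterm /fcoef /seqa ![alpha * _ + 1]addrC [in RHS]E.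
    by rewrite !exprMn; ring.
  have k0 : 0 < alpha * k.+1%:R by rewrite mulr_gt0.
  have -> : seqconv (seqa alpha) (seqa alpha) k.+1 =
      2 * seqconv (seqa alpha) (seqb alpha) k / (alpha * k.+1%:R).
    by rewrite seqconv_seqa_seqa mulrC mulKf// gt_eqF.
  rewrite /fterm /fcoef /lhs_coef (_ : 1 + alpha + alpha * k%:R = alpha * k.+1%:R + 1); last first.
    by rewrite alphaS; ring.
  rewrite (GammaS k0) -alphaS; have := Gamma_gt0 k0; move: (Gamma _) => g g0.
  by rewrite exprS exprMn; field; rewrite !gt_eqF.
have cw : series w @ \oo -->
    1 - 2 * lambda * x * fsum (1 + alpha) (fun k => 1 * (- lambda) ^+ k * lhs_coef k) x.
  rewrite -(cvg_shiftS (series w)) /=.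
  rewrite (_ : (fun n => series w n.+1) = fun n => 1 + - (2 * lambda * x) *
    series (fterm alpha (1 + alpha) (fun k => 1 * (- lambda) ^+ k * lhs_coef k) x) n); last first.
    apply/funext => n; rewrite /series/= big_nat_recl//= w0 mulr_sumr.
    by congr (_ + _); apply: eq_bigr => k _; exact: wS.
  apply: cvgD; first exact: cvg_cst.
  by rewrite -[X in _ --> X]mulNr; apply: cvgM; [exact: cvg_cst|rewrite fsumE].
have -> : fsum 1 (fun k => 1 * (- lambda) ^+ k) x ^+ 2 = limn (series w).
  by rewrite (cvg_lim _ cc)// expr2 fsumE.
by rewrite (cvg_lim _ cw)//; ring.
Qed.

Lemma f2_expansion_convolution (t : R) : 0 < t ->
  mu.-integrable `]0, t[ (fun s => (fracseries (2 * alpha - 1) f2_seq (t - s) *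
    fracseries (2 - alpha) expansion_seq s)%:E) /\
  (\int[mu]_(s in `]0%R, t[) (fracseries (2 * alpha - 1) f2_seq (t - s) *
    fracseries (2 - alpha) expansion_seq s)%:E =
   (c * lambda ^+ 2 * (1 - resolvent alpha lambda t ^+ 2))%:E)%E.
Proof.
move=> t0.
have [i ->] := fracseries_convolution alpha0 alpha2 alpha1 expbounded_f2_seq expbounded_expansion_seq t0.
split=> //; congr (_%:E).
rewrite one_sub_resolvent2// /fracseries (_ : 2 * alpha - 1 + (2 - alpha) = 1 + alpha); last ring.
have -> : seqconv f2_seq expansion_seq = fun k => 2 * c * lambda ^+ 3 * (1 * (- lambda) ^+ k * lhs_coef k).
  by apply/funext => k; rewrite seqconvX f2_coef_expansion_coef; ring.
rewrite (@fsumZ _ _ alpha0 _ _ (2 * c * lambda ^+ 3) _ (addr_gt0 ltr01 alpha0) expbounded_geom_lhs_coef).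
by rewrite (_ : 1 + alpha - 1 = alpha); ring.
Qed.

End Lambda.
End Main.

(** * Existence, continuity and uniqueness of the solution *)

Section Solution.
Context {R : realType} (alpha : R) (ck : R^nat).
Hypothesis halpha : 1 / 2 < alpha < 1.
Hypothesis hck : c_recursion alpha ck.
Variables (lambda c : R).
Hypothesis lambda0 : 0 < lambda.
Local Notation mu := (@lebesgue_measure R).

Let alpha0 : 0 < alpha.
Proof. by case/andP: halpha => h _; lra. Qed.

Let alpha1 : 1 < 2 - alpha.
Proof. by case/andP: halpha => _ h; lra. Qed.

Let alpha2 : 0 < 2 * alpha - 1.
Proof. by case/andP: halpha => h _; lra. Qed.

Let alpha3 : 0 < 2 - 2 * alpha.
Proof. by case/andP: halpha => _ h; lra. Qed.

Local Notation f2 := (fracseries alpha (2 * alpha - 1) (f2_seq alpha lambda)).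
Local Notation expansion := (varsigma2_expansion alpha lambda c ck).

Let expbounded_f2 : expbounded (f2_seq alpha lambda) := expbounded_f2_seq halpha lambda.

Lemma expansion_continuous : {within `[0, +oo[, continuous expansion}.
Proof.
have h := fracseries_continuous alpha0 alpha1 (expbounded_expansion_seq halpha hck lambda c).
apply: subspace_eq_continuous h => t.
by rewrite inE/= in_itv/= andbT => t0; exact/esym/(expansionE halpha hck).
Qed.

Lemma expansion_integrable T : 0 < T -> mu.-integrable `[0, T] (EFin \o expansion).
Proof.
move=> T0; apply: continuous_compact_integrable; first exact: segment_compact.
apply: continuous_subspaceW expansion_continuous => t /=.
by rewrite !in_itv/= => /andP[->].
Qed.

Lemma resolvent_density2_mul (phi : R -> R) (t s : R) : s \in `]0, t[%classic ->
  resolvent_density alpha lambda (t - s) ^+ 2 * phi s = f2 (t - s) * phi s.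
Proof.
by rewrite inE/= in_itv/= => /andP[s0 st]; rewrite resolvent_density2E// subr_gt0.
Qed.

Lemma expansion_solution : varsigma2_solution alpha lambda c expansion.
Proof.
split; first exact: expansion_integrable.
move=> t t0; have [i e] := f2_expansion_convolution halpha hck lambda c t0.
have E s : s \in `]0, t[%classic ->
    f2 (t - s) * fracseries alpha (2 - alpha) (expansion_seq alpha ck lambda c) s =
    resolvent_density alpha lambda (t - s) ^+ 2 * expansion s.
  move=> /[dup] sD; rewrite inE/= in_itv/= => /andP[s0 st].
  by rewrite resolvent_density2_mul// (expansionE halpha hck) ?(ltW s0).
split; first by apply: eq_integrable i => // s sD; rewrite E.
rewrite -[LHS]/(fine (_%:E)) -e /Rintegral; congr fine.
by apply: eq_integral => s sD; rewrite E.
Qed.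

(** The difference of two solutions is annihilated by convolution with the squared
density.  The complementary kernel has the coefficients inverse to [f2_seq],
which exist since [f2_seq] does not vanish at index [0]. *)
Lemma solution_unique (phi : R -> R) : varsigma2_solution alpha lambda c phi ->
  {ae mu, forall t : R, 0 <= t -> phi t = expansion t}.
Proof.
move=> [iphi sphi]; have [iexp sexp] := expansion_solution.
pose psi t := phi t - expansion t.
suff : {ae mu, forall t, 0 <= t -> psi t = 0}.
  apply: filterS; first exact: (ae_filter_ringOfSetsType mu).
  by move=> t h t0; apply/eqP; rewrite -subr_eq0; apply/eqP; exact: h.
have ipsi T : 0 < T -> mu.-integrable `[0, T] (EFin \o psi).
  move=> T0; have := @integrableB _ (measurableTypeR R) _ mu _ (measurable_itv _) _ _ (iphi _ T0) (iexp _ T0).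
  by apply: eq_integrable => // s _; rewrite /psi /= EFinB.
apply: ae_eq0_of_primitive => // T T0.
have U0 : f2_seq alpha lambda 0 != 0.
  by rewrite /f2_seq mulr1 mulf_neq0 ?expf_neq0 ?gt_eqF// f2_coef0_gt0.
pose delta : R^nat := fun k => (k == 0%N)%:R.
have [H HE] := seqconv_solve delta U0.
have edelta : expbounded delta.
  by exists 1, 1 => k; rewrite expr1n mulr1 /delta; case: eqP; rewrite ?normr1 ?normr0.
have eH : expbounded H by apply: (expbounded_div U0 expbounded_f2); rewrite HE.
pose h := fracseries alpha (2 - 2 * alpha) H.
have pq : 2 * alpha - 1 + (2 - 2 * alpha) = 1 by ring.
apply: (@primitive_eq0 _ f2 h psi _ _ alpha2 alpha3 pq) => //.
- exact: measurable_fracseries.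
- exact: measurable_fracseries.
- move=> S S0; exists (fmajor alpha (2 * alpha - 1) (f2_seq alpha lambda) (S `^ alpha)).
  by move=> t t0 tS; exact: fracseries_bound.
- move=> S S0; exists (fmajor alpha (2 - 2 * alpha) H (S `^ alpha)).
  by move=> t t0 tS; exact: fracseries_bound.
- move=> t t0; have [i e] := fracseries_convolution alpha0 alpha3 alpha2 eH expbounded_f2 t0.
  by split=> //; rewrite e addrC pq seqconvC HE fracseries1_delta.
- move=> t t0; have [ip ep] := sphi _ t0; have [ie ee] := sexp _ t0.
  have mD : measurable (`]0, t[%classic : set (measurableTypeR R)) := measurable_itv _.
  have i : mu.-integrable `]0, t[ (fun s => (f2 (t - s) * psi s)%:E).
    have := integrableB mD ip ie; apply: eq_integrable => // s sD.
    by rewrite /= !resolvent_density2_mul// -EFinB -mulrBr.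
  split=> //; rewrite -[LHS]fineK ?(integrable_fin_num mD i)//; congr (_%:E).
  transitivity (\int[mu]_(s in `]0, t[)
     (resolvent_density alpha lambda (t - s) ^+ 2 * phi s -
      resolvent_density alpha lambda (t - s) ^+ 2 * expansion s))%R.
    by congr fine; apply: eq_integral => s sD; rewrite !resolvent_density2_mul// -mulrBr.
  by rewrite RintegralB// -ep -ee subrr.
Qed.

End Solution.

Theorem propositionA1 (R : realType) (alpha : R)
    (halpha : 1 / 2 < alpha < 1)
    (ck : nat -> R) (hck : c_recursion alpha ck) :
  cvg_radius ck = +oo%E /\
  (exists K A : R,
     (Gamma (2 - alpha))^-1 <= K /\ 2 `^ alpha <= A /\
     forall k : nat,
       `|ck k| <= K * (A ^+ k / Gamma (alpha * k%:R + 2 - alpha))) /\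
  (forall lambda c : R, 0 < lambda -> 0 < c ->
     varsigma2_solution alpha lambda c
       (varsigma2_expansion alpha lambda c ck) /\
     {within `[0, +oo[, continuous (varsigma2_expansion alpha lambda c ck)} /\
     forall varsigma2 : R -> R,
       varsigma2_solution alpha lambda c varsigma2 ->
       {ae lebesgue_measure, forall t : R, 0 <= t ->
          varsigma2 t = varsigma2_expansion alpha lambda c ck t} /\
       ({within `[0, +oo[, continuous varsigma2} ->
        forall t : R, 0 <= t ->
          varsigma2 t = varsigma2_expansion alpha lambda c ck t)).
Proof.
split; first exact: (cvg_radius_ck halpha hck).
split; first exact: (ck_bound halpha hck).
move=> lambda c lambda0 c0; split; first exact: expansion_solution.
have cE : {within `[0, +oo[, continuous (varsigma2_expansion alpha lambda c ck)}.
  exact: expansion_continuous.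
split=> // phi hphi; have ae := solution_unique halpha hck lambda0 hphi.
by split=> // cphi; exact: ae_eq_continuous.
Qed.
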